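(* Let a forward or backward $CM_L$, forward or backward $CM_F$, reciprocal, or forward or backward Markov model (the seven types listed in the context) be given by $$T_1x=\xi ,$$ where $\xi=[\xi_0',\ldots,\xi_N']'$ includes the dynamic noise and the boundary values, and the covariance of $\xi$ is $P_1$. Any explicitly sample-equivalent model of one of these types (forward or backward $CM_L$, $CM_F$, reciprocal, or Markov), denoted by $$T_2x=\zeta ,$$ with $\zeta=[\zeta_0',\ldots,\zeta_N']'$ containing the corresponding dynamic noise and boundary values, with covariance $P_2$, is constructed in two steps: (1) The parameters of the equivalent model are determined based on $$T_2'P_2^{-1}T_2=T_1'P_1^{-1}T_1 .$$ Therefore, $T_2$ and $P_2$ can be obtained given their forms. (Due to the special structures of $T_1$, $P_1$, $T_2$ and $P_2$, the parameters of the second model can be easily obtained in terms of the parameters of the first model using this equation; then, having the parameters of the second model, $T_2$ and $P_2$ are known.) (2) The relationship between the dynamic noises and the boundary values of the two models is obtained through $$T_2'P_2^{-1}\zeta=T_1'P_1^{-1}\xi .$$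
   Context: A prime denotes transpose. Let $N\ge 2$ and $[i,j]=\{i,i+1,\ldots,j\}$. All sequences $[x_k]=\{x_k:k\in[0,N]\}$ are zero-mean, Gaussian, vector-valued (in $\mathbb{R}^d$), and nonsingular, i.e. the stacked vector $x=[x_0',\ldots,x_N']'$ has nonsingular covariance matrix. ''White nonsingular Gaussian (NG) noise with covariances $Q_k$'' means a zero-mean Gaussian sequence over $[0,N]$ with $E[e_ke_j']=0$ for $k\ne j$ and $E[e_ke_k']=Q_k$ nonsingular. The seven types of models are as follows (all coefficients are $d\times d$ matrices). 1. Forward Markov: $x_0=e^M_0$ and $x_k=M_{k,k-1}x_{k-1}+e^M_k$ for $k\in[1,N]$, with $[e^M_k]$ white NG noise with covariances $M_k$. 2. Backward Markov: $x_N=e^{MB}_N$ and $x_k=M^B_{k,k+1}x_{k+1}+e^{MB}_k$ for $k\in[0,N-1]$, with $[e^{MB}_k]$ white NG noise with covariances $M^B_k$. 3. Reciprocal: $R^0_kx_k-R^-_kx_{k-1}-R^+_kx_{k+1}=e^R_k$ for $k\in[1,N-1]$, with boundary conditions $R^0_0x_0-R^-_0x_N-R^+_0x_1=e^R_0$ and $R^0_Nx_N-R^-_Nx_{N-1}-R^+_Nx_0=e^R_N$. Here $[e^R_k]$ is a zero-mean NG sequence with $E[e^R_k(e^R_k)']=R^0_k$, $E[e^R_k(e^R_{k+1})']=-R^+_k$, $E[e^R_N(e^R_0)']=-R^+_N$, and $E[e^R_k(e^R_j)']=0$ for $|k-j|>1$ with $\{k,j\}\ne\{0,N\}$. Moreover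 $R^+_k=(R^-_{k+1})'$, $R^-_0=(R^+_N)'$, and the parameters of the model and boundary conditions lead to a nonsingular sequence. 4. Forward $CM_L$: $x_N=e_N$, $x_0=G_{0,N}x_N+e_0$, and $x_k=G_{k,k-1}x_{k-1}+G_{k,N}x_N+e_k$ for $k\in[1,N-1]$, with $[e_k]$ white NG noise with covariances $G_k$. 5. Forward $CM_F$: $x_0=e_0$ and $x_k=G_{k,k-1}x_{k-1}+G_{k,0}x_0+e_k$ for $k\in[1,N]$, with $[e_k]$ white NG noise with covariances $G_k$ (for $k=1$ both coefficients are the same matrix $G_{1,0}$, so $x_1=2G_{1,0}x_0+e_1$). 6. Backward $CM_L$: $x_N=e^B_N$ and $x_k=G^B_{k,k+1}x_{k+1}+G^B_{k,N}x_N+e^B_k$ for $k\in[0,N-1]$, with $[e^B_k]$ white NG noise with covariances $G^B_k$ (for $k=N-1$ both coefficients are the same matrix $G^B_{N-1,N}$). 7. Backward $CM_F$: $x_0=e^B_0$, $x_N=G^B_{N,0}x_0+e^B_N$, and $x_k=G^B_{k,k+1}x_{k+1}+G^B_{k,0}x_0+e^B_k$ for $k\in[1,N-1]$, with $[e^B_k]$ white NG noise with covariances $G^B_k$. In each case, stacking the equations in the order $k=0,\ldots,N$ gives $Tx=\xi$, where $\xi=[\xi_0',\ldots,\xi_N']'$ is the stacked vector of the dynamic noise and the boundary values, $T$ is a nonsingular matrix determined by the parameters of the model, and $P=\mathrm{Cov}(\xi)$. For each type of model, $T$ and $P$ have a specific form, namely the one arising from this stacking. Two models are equivalent if they govern the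 same sequence, i.e. their sequences have the same distribution. Two models are explicitly sample-equivalent if, given a sample path of the dynamic noise and the boundary values of one model for an arbitrary sample path of the governed sequence, a sample path of the dynamic noise and the boundary values of the other model leading to the same sample path of the governed sequence is given explicitly. *)

(* Defs.v *)
From HB Require Import structures.
From mathcomp Require Import all_boot all_order all_algebra.
From mathcomp Require Import all_classical all_reals all_analysis.

Set Implicit Arguments.
Unset Strict Implicit.
Unset Printing Implicit Defensive.

Import Order.TTheory GRing.Theory Num.Theory.
Import numFieldNormedType.Exports.

Local Open Scope classical_set_scope.
Local Open Scope ring_scope.

Section gaussian_vectors.
Context {d1 : measure_display} {Omega : measurableType d1} {R : realType}.
Variable Pr : probability Omega R.

(* By convention [normal_prob 0 0] is the uniform law on [0, 1], so the
   degenerate case s = 0 is given as a Dirac mass. *)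
Definition centered_normal (Z : Omega -> R) : Prop :=
  exists s : R, forall B : set R, measurable B ->
    Pr (Z @^-1` B) = (if s == 0 then \d_(0 : R) B else normal_prob 0 s B).

(* A zero-mean, jointly Gaussian, possibly degenerate random vector. *)
Definition centered_gaussian n (X : Omega -> 'cV[R]_n) : Prop :=
  (forall i, measurable_fun setT (fun w => X w i 0)) /\
  (forall a : 'rV[R]_n, centered_normal (fun w => (a *m X w) 0 0)).

Definition has_covariance n (X : Omega -> 'cV[R]_n) (S : 'M[R]_n) : Prop :=
  forall i j, covariance Pr (fun w => X w i 0) (fun w => X w j 0) = (S i j)%:E.

End gaussian_vectors.

(* [g_sigma_preimage] of the coordinate maps is the product (Borel)
   sigma-algebra of R^n. *)
Definition same_distribution {R : realType} n
    {d1 : measure_display} {Omega1 : measurableType d1}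
    (Pr1 : probability Omega1 R) (X : Omega1 -> 'cV[R]_n)
    {d2 : measure_display} {Omega2 : measurableType d2}
    (Pr2 : probability Omega2 R) (Y : Omega2 -> 'cV[R]_n) : Prop :=
  forall B : set 'cV[R]_n,
    g_sigma_preimage (fun (i : 'I_n) (v : 'cV[R]_n) => v i 0 : R) B ->
    Pr1 (X @^-1` B) = Pr2 (Y @^-1` B).

Definition nonsingular_covariance {R : realType} n (S : 'M[R]_n) : Prop :=
  [/\ S^T = S, forall v : 'cV[R]_n, 0 <= (v^T *m S *m v) 0 0 & S \in unitmx].

(* The coefficients are indexed by the time k of the equation they occur in;
   values at times whose equation has no such coefficient are ignored.
   The last argument (R0 for the reciprocal model) gives the covariances of the
   noise and boundary values:
     ForwardMarkov M Q        : M k = M_{k,k-1}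
     BackwardMarkov M Q       : M k = M^B_{k,k+1}
     Reciprocal Rm Rp R0      : Rm k = R^-_k,       Rp k = R^+_k
     ForwardCML G H Q         : G k = G_{k,k-1},    H k = G_{k,N}
     ForwardCMF G H Q         : G k = G_{k,k-1},    H k = G_{k,0}
     BackwardCML G H Q        : G k = G^B_{k,k+1},  H k = G^B_{k,N}
     BackwardCMF G H Q        : G k = G^B_{k,k+1},  H k = G^B_{k,0} *)
Inductive model (R : realType) (d : nat) : Type :=
  | ForwardMarkov (M Q : nat -> 'M[R]_d)
  | BackwardMarkov (M Q : nat -> 'M[R]_d)
  | Reciprocal (Rm Rp R0 : nat -> 'M[R]_d)
  | ForwardCML (G H Q : nat -> 'M[R]_d)
  | ForwardCMF (G H Q : nat -> 'M[R]_d)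
  | BackwardCML (G H Q : nat -> 'M[R]_d)
  | BackwardCMF (G H Q : nat -> 'M[R]_d).

Section models.
Variables (R : realType) (d N : nat).

(* The stacked vector of a path over [0, N]. *)
Definition trajectory := 'cV[R]_(\sum_(k < N.+1) d).

Definition value_at (x : trajectory) (k : nat) : 'cV[R]_d :=
  submxcol (p_ := fun _ : 'I_N.+1 => d) x (inord k).

Local Notation "x .@ k" := (value_at x k) (at level 8, k at level 2).

Definition equations (m : model R d) (x e : trajectory) : Prop :=
  match m with
  | ForwardMarkov M _ =>
      x.@0 = e.@0 /\
      (forall k, (1 <= k <= N)%N -> x.@k = M k *m x.@k.-1 + e.@k)
  | BackwardMarkov M _ =>
      x.@N = e.@N /\
      (forall k, (k < N)%N -> x.@k = M k *m x.@k.+1 + e.@k)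
  | Reciprocal Rm Rp R0 =>
      [/\ R0 0%N *m x.@0 - Rm 0%N *m x.@N - Rp 0%N *m x.@1 = e.@0,
          R0 N *m x.@N - Rm N *m x.@N.-1 - Rp N *m x.@0 = e.@N &
          forall k, (1 <= k <= N.-1)%N ->
            R0 k *m x.@k - Rm k *m x.@k.-1 - Rp k *m x.@k.+1 = e.@k]
  | ForwardCML G H _ =>
      [/\ x.@N = e.@N,
          x.@0 = H 0%N *m x.@N + e.@0 &
          forall k, (1 <= k <= N.-1)%N ->
            x.@k = G k *m x.@k.-1 + H k *m x.@N + e.@k]
  | ForwardCMF G H _ =>
      x.@0 = e.@0 /\
      (forall k, (1 <= k <= N)%N ->
         x.@k = G k *m x.@k.-1 + H k *m x.@0 + e.@k)
  | BackwardCML G H _ =>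
      x.@N = e.@N /\
      (forall k, (k < N)%N ->
         x.@k = G k *m x.@k.+1 + H k *m x.@N + e.@k)
  | BackwardCMF G H _ =>
      [/\ x.@0 = e.@0,
          x.@N = H N *m x.@0 + e.@N &
          forall k, (1 <= k <= N.-1)%N ->
            x.@k = G k *m x.@k.+1 + H k *m x.@0 + e.@k]
  end.

Definition cyc_pred (k : nat) : nat := if k == 0%N then N else k.-1.
Definition cyc_succ (k : nat) : nat := if k == N then 0%N else k.+1.

(* The matrix T obtained by stacking the equations as T x = e (see
   [equations_stack]). A term [A *+ b], with b a boolean, is A or 0. *)
Definition stack_block (m : model R d) (i j : nat) : 'M[R]_d :=
  match m with
  | ForwardMarkov M _ => 1%:M *+ (j == i) - M i *+ ((j == i.-1) && (0 < i)%N)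
  | BackwardMarkov M _ => 1%:M *+ (j == i) - M i *+ ((j == i.+1) && (i < N)%N)
  | Reciprocal Rm Rp R0 =>
      R0 i *+ (j == i) - Rm i *+ (j == cyc_pred i) - Rp i *+ (j == cyc_succ i)
  | ForwardCML G H _ =>
      1%:M *+ (j == i) - G i *+ ((j == i.-1) && (0 < i < N)%N)
                       - H i *+ ((j == N) && (i < N)%N)
  | ForwardCMF G H _ =>
      1%:M *+ (j == i) - G i *+ ((j == i.-1) && (0 < i)%N)
                       - H i *+ ((j == 0%N) && (0 < i)%N)
  | BackwardCML G H _ =>
      1%:M *+ (j == i) - G i *+ ((j == i.+1) && (i < N)%N)
                       - H i *+ ((j == N) && (i < N)%N)
  | BackwardCMF G H _ =>
      1%:M *+ (j == i) - G i *+ ((j == i.+1) && (0 < i < N)%N)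
                       - H i *+ ((j == 0%N) && (0 < i)%N)
  end.

Definition Tmx (m : model R d) : 'M[R]_(\sum_(k < N.+1) d) :=
  \mxblock_(i < N.+1, j < N.+1) stack_block m i j.

(* For the reciprocal model the blocks below the diagonal and at (0, N) are the
   transposes E[e_j e_i']' of the prescribed E[e_k e_{k+1}'] = - R^+_k and
   E[e_N e_0'] = - R^+_N. *)
Definition cov_block (m : model R d) (i j : nat) : 'M[R]_d :=
  match m with
  | ForwardMarkov _ Q | BackwardMarkov _ Q
  | ForwardCML _ _ Q | ForwardCMF _ _ Q
  | BackwardCML _ _ Q | BackwardCMF _ _ Q => Q i *+ (j == i)
  | Reciprocal _ Rp R0 =>
      if j == i then R0 i
      else if j == cyc_succ i then - Rp i
      else if i == cyc_succ j then - (Rp j)^T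
      else 0
  end.

Definition Pmx (m : model R d) : 'M[R]_(\sum_(k < N.+1) d) :=
  \mxblock_(i < N.+1, j < N.+1) cov_block m i j.

(* For the reciprocal model the last condition is the requirement that the
   parameters lead to a nonsingular sequence. *)
Definition constraints (m : model R d) : Prop :=
  match m with
  | Reciprocal Rm Rp _ =>
      [/\ forall k, (k < N)%N -> Rp k = (Rm k.+1)^T,
          Rm 0%N = (Rp N)^T & Tmx m \in unitmx]
  | ForwardCMF G H _ => G 1%N = H 1%N
  | BackwardCML G H _ => G N.-1 = H N.-1
  | _ => True
  end.

Definition admissible (m : model R d) : Prop :=
  constraints m /\ nonsingular_covariance (Pmx m).

Definition is_noise (m : model R d)
    {d1 : measure_display} {Omega : measurableType d1}
    (Pr : probability Omega R) (e : Omega -> trajectory) : Prop :=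
  centered_gaussian Pr e /\ has_covariance Pr e (Pmx m).

Definition governs (m : model R d)
    {d1 : measure_display} {Omega : measurableType d1}
    (Pr : probability Omega R) (x e : Omega -> trajectory) : Prop :=
  [/\ admissible m, is_noise m Pr e & forall w, equations m (x w) (e w)].

(* [Phi] turns a sample path of the noise and boundary values of [m1] into one
   of [m2] which leads to the same sample path of the governed sequence. *)
Definition explicitly_sample_equivalent (m1 m2 : model R d)
    (Phi : trajectory -> trajectory) : Prop :=
  (forall (d1 : measure_display) (Omega : measurableType d1)
      (Pr : probability Omega R) (e : Omega -> trajectory),
      is_noise m1 Pr e -> is_noise m2 Pr (Phi \o e)) /\
  (forall x e : trajectory, equations m1 x e -> equations m2 x (Phi e)).

Definition same_type (m m' : model R d) : bool :=
  match m, m' with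
  | ForwardMarkov _ _, ForwardMarkov _ _
  | BackwardMarkov _ _, BackwardMarkov _ _
  | Reciprocal _ _ _, Reciprocal _ _ _
  | ForwardCML _ _ _, ForwardCML _ _ _
  | ForwardCMF _ _ _, ForwardCMF _ _ _
  | BackwardCML _ _ _, BackwardCML _ _ _
  | BackwardCMF _ _ _, BackwardCMF _ _ _ => true
  | _, _ => false
  end.

Definition eq_on (I : pred nat) (A B : nat -> 'M[R]_d) : Prop :=
  forall k, I k -> A k = B k.

(* Equality of all the coefficients and covariances that occur in the model. *)
Definition same_parameters (m m' : model R d) : Prop :=
  let all_ := [pred k | (k <= N)%N] in
  let init := [pred k | (k < N)%N] in
  let tail := [pred k | (1 <= k <= N)%N] in
  let inner := [pred k | (1 <= k <= N.-1)%N] in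
  match m, m' with
  | ForwardMarkov M Q, ForwardMarkov M' Q' =>
      eq_on tail M M' /\ eq_on all_ Q Q'
  | BackwardMarkov M Q, BackwardMarkov M' Q' =>
      eq_on init M M' /\ eq_on all_ Q Q'
  | Reciprocal Rm Rp R0, Reciprocal Rm' Rp' R0' =>
      [/\ eq_on all_ Rm Rm', eq_on all_ Rp Rp' & eq_on all_ R0 R0']
  | ForwardCML G H Q, ForwardCML G' H' Q' =>
      [/\ eq_on inner G G', eq_on init H H' & eq_on all_ Q Q']
  | ForwardCMF G H Q, ForwardCMF G' H' Q' =>
      [/\ eq_on tail G G', eq_on tail H H' & eq_on all_ Q Q']
  | BackwardCML G H Q, BackwardCML G' H' Q' =>
      [/\ eq_on init G G', eq_on init H H' & eq_on all_ Q Q']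
  | BackwardCMF G H Q, BackwardCMF G' H' Q' =>
      [/\ eq_on inner G G', eq_on tail H H' & eq_on all_ Q Q']
  | _, _ => False
  end.

Lemma value_at_inj (x y : trajectory) :
  (forall k, (k <= N)%N -> x.@k = y.@k) -> x = y.
Proof.
move=> xy; rewrite -[x](submxcolK (p_ := fun _ : 'I_N.+1 => d)).
rewrite -[y](submxcolK (p_ := fun _ : 'I_N.+1 => d)); apply/eq_mxcol => i.
by have := xy i (leq_ord i); rewrite /value_at inord_val.
Qed.

Lemma sum_pick (A : 'M[R]_d) (b : bool) (c : nat) (x : trajectory) :
  (b -> c <= N)%N ->
  \sum_(j < N.+1) (A *+ ((j == c :> nat) && b)) *m
     submxcol (p_ := fun _ : 'I_N.+1 => d) x j = (A *m x.@c) *+ b.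
Proof.
case: b => [/(_ isT) cN|_]; last first.
  by rewrite big1// => j _; rewrite andbF mulr0n mul0mx.
rewrite (bigD1 (inord c))//= inordK// eqxx mulr1n big1 ?addr0// => j jc.
case: eqP => [E|_]; last by rewrite mul0mx.
by case/eqP: jc; apply: val_inj; rewrite /= inordK.
Qed.

Lemma value_at_Tmx (m : model R d) (x : trajectory) k : (k <= N)%N ->
  (Tmx m *m x : trajectory).@k = \sum_(j < N.+1) stack_block m k j *m
     submxcol (p_ := fun _ : 'I_N.+1 => d) x j.
Proof.
move=> kN; rewrite /value_at /Tmx.
rewrite -{1}[x](submxcolK (p_ := fun _ : 'I_N.+1 => d)).
rewrite mxblockEh mul_mxrow_mxcol submxcol_sum; apply: eq_bigr => j _.
by rewrite -submxcol_mul mxcolK inordK.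
Qed.

Lemma equations_stack (m : model R d) (x e : trajectory) : (1 < N)%N ->
  equations m x e <-> Tmx m *m x = e.
Proof.
move=> N1; have N0 : (0 < N)%N by exact: ltnW.
have TxE : Tmx m *m x = e <->
    (forall k, (k <= N)%N -> \sum_(j < N.+1) stack_block m k j *m
       submxcol (p_ := fun _ : 'I_N.+1 => d) x j = e.@k).
  split=> [<- k kN|H]; first by rewrite value_at_Tmx.
  by apply: value_at_inj => k kN; rewrite value_at_Tmx// H.
have diag (A : 'M[R]_d) (c : nat) : (c <= N)%N ->
    \sum_(j < N.+1) (A *+ (j == c :> nat)) *m
       submxcol (p_ := fun _ : 'I_N.+1 => d) x j = A *m x.@c.
  move=> cN; rewrite -[RHS]mulr1n -[in RHS](sum_pick A (b := true))//.
  by apply: eq_bigr => j _; rewrite andbT.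
have mul3 (A B C : nat -> 'M[R]_d) :
    \sum_(j < N.+1) (A j - B j - C j) *m
       submxcol (p_ := fun _ : 'I_N.+1 => d) x j =
    \sum_(j < N.+1) A j *m submxcol (p_ := fun _ : 'I_N.+1 => d) x j -
    \sum_(j < N.+1) B j *m submxcol (p_ := fun _ : 'I_N.+1 => d) x j -
    \sum_(j < N.+1) C j *m submxcol (p_ := fun _ : 'I_N.+1 => d) x j.
  by rewrite -!sumrB; apply: eq_bigr => j _; rewrite !mulmxBl.
have mul2 (A B : nat -> 'M[R]_d) :
    \sum_(j < N.+1) (A j - B j) *m
       submxcol (p_ := fun _ : 'I_N.+1 => d) x j =
    \sum_(j < N.+1) A j *m submxcol (p_ := fun _ : 'I_N.+1 => d) x j -
    \sum_(j < N.+1) B j *m submxcol (p_ := fun _ : 'I_N.+1 => d) x j.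
  by rewrite -!sumrB; apply: eq_bigr => j _; rewrite !mulmxBl.
rewrite TxE; case: m TxE => [M Q|M Q|Rm Rp R0|G H Q|G H Q|G H Q|G H Q] _ /=.
- have E k : (k <= N)%N -> \sum_(j < N.+1) stack_block (ForwardMarkov M Q) k j *m
       submxcol (p_ := fun _ : 'I_N.+1 => d) x j =
       x.@k - (M k *m x.@k.-1) *+ (0 < k)%N.
    move=> kN; rewrite /stack_block (mul2 (fun j => 1%:M *+ (j == k))
      (fun j => M k *+ ((j == k.-1) && (0 < k)%N)))/= diag// mul1mx sum_pick//.
    by move=> _; apply: leq_trans kN; exact: leq_pred.
  split=> [[H0 H1] k kN|H].
    rewrite [LHS]E//; case: k kN => [|k] kN; first by rewrite subr0.
    by rewrite mulr1n (H1 k.+1)// addrAC subrr add0r.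
  split=> [|k /andP[k0 kN]]; first by rewrite -H// [RHS]E// subr0.
  by rewrite -H// E// k0 mulr1n addrC subrK.
- have E k : (k <= N)%N -> \sum_(j < N.+1) stack_block (BackwardMarkov M Q) k j *m
       submxcol (p_ := fun _ : 'I_N.+1 => d) x j =
       x.@k - (M k *m x.@k.+1) *+ (k < N)%N.
    by move=> kN; rewrite /stack_block (mul2 (fun j => 1%:M *+ (j == k))
      (fun j => M k *+ ((j == k.+1) && (k < N)%N)))/= diag// mul1mx sum_pick.
  split=> [[H0 H1] k kN|H].
    rewrite [LHS]E//; move: kN; rewrite leq_eqVlt => /orP[/eqP->|kN].
      by rewrite ltnn subr0.
    by rewrite kN mulr1n H1// addrAC subrr add0r.
  split=> [|k kN]; first by rewrite -H// [RHS]E// ltnn subr0.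
  by have kN' := ltnW kN; rewrite -H// E// kN mulr1n addrC subrK.
- have E k : (k <= N)%N -> \sum_(j < N.+1) stack_block (Reciprocal Rm Rp R0) k j *m
       submxcol (p_ := fun _ : 'I_N.+1 => d) x j =
       R0 k *m x.@k - Rm k *m x.@(cyc_pred k) - Rp k *m x.@(cyc_succ k).
    move=> kN; rewrite /stack_block (mul3 (fun j => R0 k *+ (j == k))
      (fun j => Rm k *+ (j == cyc_pred k))
      (fun j => Rp k *+ (j == cyc_succ k)))/= !diag// /cyc_pred /cyc_succ.
      by case: eqP => // /eqP kN'; rewrite ltn_neqAle kN'.
    by case: eqP => // _; apply: leq_trans kN; exact: leq_pred.
  split=> [[H0 HN Hk] k kN|H].
    rewrite [LHS]E// /cyc_pred /cyc_succ.
    have [->|k0] := eqVneq k 0%N; first by rewrite eq_sym gtn_eqF.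
    have [->//|kN'] := eqVneq k N; apply: Hk; rewrite lt0n k0/=.
    by rewrite -ltnS prednK// ltn_neqAle kN'.
  split=> [||k /andP[k0 kN]].
  + by have := H 0%N isT; rewrite E// /cyc_pred /cyc_succ/= eq_sym gtn_eqF.
  + by have := H N (leqnn N); rewrite E// /cyc_pred /cyc_succ gtn_eqF// eqxx.
  + have kN' : (k < N)%N by rewrite -(prednK N0) ltnS.
    have kN2 := ltnW kN'; have := H k kN2; rewrite E// /cyc_pred /cyc_succ.
    by rewrite gtn_eqF// ltn_eqF.
- have E k : (k <= N)%N -> \sum_(j < N.+1) stack_block (ForwardCML G H Q) k j *m
       submxcol (p_ := fun _ : 'I_N.+1 => d) x j =
       x.@k - (G k *m x.@k.-1) *+ (0 < k < N)%N - (H k *m x.@N) *+ (k < N)%N.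
    move=> kN; rewrite /stack_block (mul3 (fun j => 1%:M *+ (j == k))
      (fun j => G k *+ ((j == k.-1) && (0 < k < N)%N))
      (fun j => H k *+ ((j == N) && (k < N)%N)))/= diag// mul1mx !sum_pick//.
    by move=> _; apply: leq_trans kN; exact: leq_pred.
  split=> [[H0 HN Hk] k kN|HH].
    rewrite [LHS]E//; have [->|kN'] := eqVneq k N.
      by rewrite ltnn andbF !subr0.
    have {}kN' : (k < N)%N by rewrite ltn_neqAle kN'.
    rewrite kN' andbT mulr1n; case: k kN kN' => [|k] kN kN'.
      by rewrite subr0 HN addrAC subrr add0r.
    rewrite /= mulr1n Hk/=; last by rewrite -ltnS prednK.
    by rewrite -addrA -opprD addrAC subrr add0r.
  split=> [||k /andP[k0 kN]].
  + by rewrite -HH// [RHS]E// ltnn andbF !subr0.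
  + by rewrite -HH// E// N0 subr0 mulr1n addrC subrK.
  + have kN' : (k < N)%N by rewrite -(prednK N0) ltnS.
    have kN2 := ltnW kN'; rewrite -HH// E// k0 kN' !mulr1n.
    by rewrite addrC -[X in X + _]addrA -opprD subrK.
- have E k : (k <= N)%N -> \sum_(j < N.+1) stack_block (ForwardCMF G H Q) k j *m
       submxcol (p_ := fun _ : 'I_N.+1 => d) x j =
       x.@k - (G k *m x.@k.-1) *+ (0 < k)%N - (H k *m x.@0) *+ (0 < k)%N.
    move=> kN; rewrite /stack_block (mul3 (fun j => 1%:M *+ (j == k))
      (fun j => G k *+ ((j == k.-1) && (0 < k)%N))
      (fun j => H k *+ ((j == 0%N) && (0 < k)%N)))/= diag// mul1mx !sum_pick//.
    by move=> _; apply: leq_trans kN; exact: leq_pred.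
  split=> [[H0 Hk] k kN|HH].
    rewrite [LHS]E//; case: k kN => [|k] kN; first by rewrite !subr0.
    by rewrite /= !mulr1n (Hk k.+1)//= -addrA -opprD addrAC subrr add0r.
  split=> [|k /andP[k0 kN]]; first by rewrite -HH// [RHS]E// !subr0.
  by rewrite -HH// E// k0 !mulr1n addrC -[X in X + _]addrA -opprD subrK.
- have E k : (k <= N)%N -> \sum_(j < N.+1) stack_block (BackwardCML G H Q) k j *m
       submxcol (p_ := fun _ : 'I_N.+1 => d) x j =
       x.@k - (G k *m x.@k.+1) *+ (k < N)%N - (H k *m x.@N) *+ (k < N)%N.
    by move=> kN; rewrite /stack_block (mul3 (fun j => 1%:M *+ (j == k))
      (fun j => G k *+ ((j == k.+1) && (k < N)%N))
      (fun j => H k *+ ((j == N) && (k < N)%N)))/= diag// mul1mx !sum_pick.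
  split=> [[H0 Hk] k kN|HH].
    rewrite [LHS]E//; move: kN; rewrite leq_eqVlt => /orP[/eqP->|kN].
      by rewrite ltnn !subr0.
    by rewrite kN !mulr1n Hk// -addrA -opprD addrAC subrr add0r.
  split=> [|k kN]; first by rewrite -HH// [RHS]E// ltnn !subr0.
  have kN' := ltnW kN; rewrite -HH// E// kN !mulr1n.
  by rewrite addrC -[X in X + _]addrA -opprD subrK.
- have E k : (k <= N)%N -> \sum_(j < N.+1) stack_block (BackwardCMF G H Q) k j *m
       submxcol (p_ := fun _ : 'I_N.+1 => d) x j =
       x.@k - (G k *m x.@k.+1) *+ (0 < k < N)%N - (H k *m x.@0) *+ (0 < k)%N.
    by move=> kN; rewrite /stack_block (mul3 (fun j => 1%:M *+ (j == k))
      (fun j => G k *+ ((j == k.+1) && (0 < k < N)%N))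
      (fun j => H k *+ ((j == 0%N) && (0 < k)%N)))/= diag// mul1mx !sum_pick// => /andP[].
  split=> [[H0 HN Hk] k kN|HH].
    rewrite [LHS]E//; case: k kN => [|k] kN; first by rewrite !subr0.
    have [->|kN'] := eqVneq k.+1 N.
      by rewrite ltnn andbF N0 subr0 mulr1n HN addrAC subrr add0r.
    have {}kN' : (k.+1 < N)%N by rewrite ltn_neqAle kN'.
    rewrite kN' /= !mulr1n Hk/=; last by rewrite -ltnS prednK.
    by rewrite -addrA -opprD addrAC subrr add0r.
  split=> [||k /andP[k0 kN]].
  + by rewrite -HH// [RHS]E// !subr0.
  + by rewrite -HH// E// ltnn andbF N0 subr0 mulr1n addrC subrK.
  + have kN' : (k < N)%N by rewrite -(prednK N0) ltnS.
    have kN2 := ltnW kN'; rewrite -HH// E// k0 kN' !mulr1n.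
    by rewrite addrC -[X in X + _]addrA -opprD subrK.
Qed.

End models.

(* Main.v *)
Require Import Defs.
From HB Require Import structures.
From mathcomp Require Import all_boot all_order all_algebra.
From mathcomp Require Import all_classical all_reals all_analysis measurable_realfun.
From mathcomp Require Import ring lra zify.

(* A model T x = xi governs the centered Gaussian vector x = T^-1 xi, whose
   covariance T^-1 P T^-T has inverse T' P^-1 T.  A centered Gaussian law is
   determined by its covariance: the law of a x is normal with variance a S a' for
   every row a, and by Cramer-Wold these laws determine that of x.  So equivalence
   of models is step (1), and then the noises are related by zeta = T_2 T_1^-1 xi,
   which is step (2).  The parameters are determined by T' P^-1 T because, for a
   suitable order of the times, T is block unitriangular and P block diagonal, and
   such a factorization is unique; for a reciprocal model T = P, so that
   T' P^-1 T = P. *)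

Set Implicit Arguments.
Unset Strict Implicit.
Unset Printing Implicit Defensive.

Import Order.TTheory GRing.Theory Num.Theory.
Import numFieldNormedType.Exports.

Local Open Scope classical_set_scope.
Local Open Scope ring_scope.

(** * Scalar normal laws *)

(** Two obstacles shape the probabilistic half. [centered_normal] only asserts that some parameter
    [s] exists, with no stated relation to the covariance; instead of computing second moments of
    the density, normal laws are compared by scaling, because a finite nonzero variance leaves only
    one possible scale. Cramer-Wold is proved without Fourier inversion: the projections are tested
    against cosines only, and half-spaces are reached through square waves whose period tends to
    infinity, a square wave being a pointwise limit of polynomials in a sine. On the algebraic side,
    the triangular factorization returns blocks of [T], not coefficients of the model. A coefficient
    can be read off its block unless two coefficients share that block; there the convention [G = H]
    is what separates them. *)

Lemma normal_prob_scale_ray (R : realType) (s k a : R) : s != 0 -> 0 < k ->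
  normal_prob 0 s [set` `[a, +oo[] = normal_prob 0 (k * s) [set` `[k * a, +oo[].
Proof.
move=> s0 k0; rewrite /normal_prob.
have D : (fun x : R => k * x)^`()%classic = cst k.
  apply/funext => x; rewrite derive1E deriveM// derive_cst derive_id.
  by rewrite scaler0 addr0 scaler1.
have ks0 : k * s != 0 by rewrite mulf_neq0// gt_eqF.
rewrite (@increasing_ge0_integration_by_substitutiony R (fun x => k * x)); first last.
- by move=> x _; exact: normal_pdf_ge0.
- by apply: continuous_subspaceT; exact: continuous_normal_pdf.
- by apply/gt0_cvgMry.
- split.
  + by move=> x _; exact: derivableM.
  + by apply: cvg_at_right_filter; apply: cvgMr; exact: cvg_id.
- by rewrite D; exact: is_cvg_cst.
- by rewrite D; exact: is_cvg_cst.
- by rewrite D => ? _; exact: cvg_cst.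
- by move=> x y _ _; rewrite ltr_pM2l.
apply: eq_integral => x _; rewrite D/=.
rewrite (normal_pdfE _ s0) [in RHS]fctE/= (normal_pdfE _ ks0).
(* The Jacobian [k] cancels the factor [1 / k] by which the peak of the density shrinks, and the
   exponents agree because [(k x)^2 / (k s)^2 = x^2 / s^2]. *)
congr EFin; rewrite mulrAC; congr (_ * _).
  rewrite /normal_peak; set q := s ^+ 2 * pi *+ 2.
  have -> : (k * s) ^+ 2 * pi *+ 2 = k ^+ 2 * q by rewrite /q; ring.
  rewrite (sqrtrM _ (sqr_ge0 k)).
  by rewrite sqrtr_sqr gtr0_norm// invfM mulrAC mulVf ?mul1r// gt_eqF.
rewrite /normal_fun !subr0; congr expR; field.
by rewrite s0 gt_eqF.
Qed.

(** [centered_normal] allows a negative [s], so parameters have to be compared through their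
    absolute values. *)
Lemma normal_probN (R : realType) (s : R) :
  normal_prob 0 (- s) = normal_prob 0 s.
Proof.
apply/funext => B; apply: eq_integral => x _.
by rewrite /normal_pdf oppr_eq0 /normal_peak /normal_fun !sqrrN.
Qed.

(** Closed rays are stable under intersection and generate the Borel sets, so the identity extends
    from rays to all of them. *)
Lemma normal_prob_scale (R : realType) (s k : R) (B : set R) :
  s != 0 -> 0 < k -> measurable B ->
  normal_prob 0 s ((fun x => k * x) @^-1` B) = normal_prob 0 (k * s) B.
Proof.
move=> s0 k0 mB.
have mk : @measurable_fun _ _ (measurableTypeR R) (measurableTypeR R) setT
    (fun x : R => k * x).
  exact: measurable_funM.
pose X : {mfun measurableTypeR R >-> measurableTypeR R} :=
  HB.pack (fun x : R => k * x) (isMeasurableFun.Build _ _ _ _ _ mk).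
rewrite -[LHS]/(distribution (normal_prob 0 s) X B).
refine (@measure_unique _ R (measurableTypeR R) (@RGenCInfty.G R)
  (fun n => `[- n%:R, +oo[%classic) _ _ _ _
  (distribution (normal_prob 0 s) X) (normal_prob 0 (k * s)) _ _ B mB) => //.
- exact: RGenCInfty.measurableE.
- move=> _ _ [a ->] [b ->]; exists (Num.max a b).
  apply/seteqP; split => x /=; rewrite !in_itv/= !andbT ge_max.
    by move=> [-> ->].
  by move/andP.
- by move=> n; exists (- n%:R).
- apply/seteqP; split => // x _; exists (Num.bound x) => //=.
  rewrite in_itv/= andbT lerNl (le_trans (ler_norm _))// normrN.
  exact/ltW/unstable.ltr_norm_bound.
- move=> _ [a ->]; rewrite [LHS]/=.
  have -> : (fun x : R => k * x) @^-1` `[a, +oo[ = `[a / k, +oo[%classic.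
    by apply/seteqP; split => x /=; rewrite !in_itv/= !andbT ler_pdivrMr// mulrC.
  by rewrite (normal_prob_scale_ray _ s0 k0) mulrCA divff ?mulr1// gt_eqF.
- by move=> n; rewrite (le_lt_trans (probability_le1 _ _)) ?ltry.
Qed.

Definition same_law (R : realType) d1 (T1 : measurableType d1)
    (P1 : probability T1 R) (X : T1 -> R) d2 (T2 : measurableType d2)
    (P2 : probability T2 R) (Y : T2 -> R) : Prop :=
  forall B : set R, measurable B -> P1 (X @^-1` B) = P2 (Y @^-1` B).

Section same_law.
Context (R : realType) d1 (T1 : measurableType d1) (P1 : probability T1 R)
  d2 (T2 : measurableType d2) (P2 : probability T2 R).
Variables (X : T1 -> R) (Y : T2 -> R).
Hypotheses (mX : measurable_fun setT X) (mY : measurable_fun setT Y).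
Hypothesis XY : same_law P1 X P2 Y.

(** Both sides are integrals against the same image measure. Positive and negative parts are treated
    separately, so integrability of [f] never enters. *)
Lemma same_law_expectation (f : R -> R) : measurable_fun setT f ->
  ('E_P1[f \o X] = 'E_P2[f \o Y])%E.
Proof.
move=> mf; have mEf : measurable_fun setT (EFin \o f) by exact/measurable_EFinP.
have nonneg (g : R -> \bar R) : measurable_fun setT g -> (forall x, 0 <= g x)%E ->
    (\int[P1]_w g (X w) = \int[P2]_w g (Y w))%E.
  move=> mg g0.
  transitivity (\int[pushforward P1 X]_y g y)%E.
    by rewrite ge0_integral_pushforward// => y _; exact: g0.
  transitivity (\int[pushforward P2 Y]_y g y)%E.
    by apply: eq_measure_integral => A mA _; exact: XY.
  by rewrite ge0_integral_pushforward// => y _; exact: g0.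
rewrite unlock integralE [RHS]integralE; congr (_ - _)%E.
  have := nonneg ((EFin \o f)^\+)%E (measurable_funepos mEf) (funepos_ge0 _).
  by rewrite unlock.
have := nonneg ((EFin \o f)^\-)%E (measurable_funeneg mEf) (funeneg_ge0 _).
by rewrite unlock.
Qed.

(** The centring constant, [fine] of the expectation, is common to [X] and [Y] even if the
    expectation is infinite; the variance is then the expectation of one fixed function of the
    variable. *)
Lemma same_law_variance : ('V_P1[X] = 'V_P2[Y])%E.
Proof.
rewrite /variance !covariance.unlock.
rewrite (same_law_expectation (f := id))//.
set c := fine _.
apply: (same_law_expectation (f := fun x => (x - c) * (x - c))).
by apply: measurable_funM; exact: measurable_funB.
Qed.

End same_law.

Lemma variance0_ae (R : realType) d (T : measurableType d) (P : probability T R)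
    (X : T -> R) : measurable_fun setT X -> 'V_P[X]%E = 0%E ->
  exists c, P (X @^-1` [set c]) = 1%E.
Proof.
move=> mX; rewrite /variance covariance.unlock; set c := fine _ => E0; exists c.
have mXc : measurable_fun setT (fun w => ((X w - c) * (X w - c))%:E).
  apply/measurable_EFinP.
  by apply: measurable_funM; apply: measurable_funB.
have : (\int[P]_w `|((X w - c) * (X w - c))%:E| = 0)%E.
  rewrite -[RHS]E0 unlock; apply: eq_integral => w _ /=.
  by rewrite ger0_norm// -expr2 sqr_ge0.
move/ae_eq_integral_abs => /(_ measurableT mXc)[N [mN PN XN]].
have mc : measurable (X @^-1` [set c]).
  by rewrite -[X in measurable X]setTI; apply: mX.
have : (P (~` (X @^-1` [set c])) <= 0)%E.
  rewrite -PN; apply: le_measure; rewrite ?inE//; first exact: measurableC.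
  move=> w /= Xwc; apply: XN => /= /(_ I)[] /eqP.
  by rewrite mulf_eq0 orbb subr_eq0 => /eqP.
move=> PC; rewrite -(setCK (X @^-1` [set c])) probability_setC; last exact: measurableC.
by move: PC; rewrite measure_le0 => /eqP ->; rewrite sube0.
Qed.

(** Zero variance separates the Dirac case from the normal one. In the normal case, [X] rescaled by
    [k = |t| / |s|] has the law of [Y], so the common variance [V] satisfies [k^2 V = V]; as [V] is
    finite and nonzero and [k > 0], this gives [k = 1]. *)
Lemma eq_variance_same_law (R : realType)
    d1 (T1 : measurableType d1) (P1 : probability T1 R) (X : T1 -> R)
    d2 (T2 : measurableType d2) (P2 : probability T2 R) (Y : T2 -> R) :
  X \in Lfun P1 2%:E -> Y \in Lfun P2 2%:E ->
  centered_normal P1 X -> centered_normal P2 Y ->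
  ('V_P1[X] = 'V_P2[Y])%E -> same_law P1 X P2 Y.
Proof.
move=> X2 Y2 [s Xs] [t Yt] VXY.
have mX : measurable_fun setT X by have := sub_Lfun_mfun X2; rewrite inE.
have mY : measurable_fun setT Y by have := sub_Lfun_mfun Y2; rewrite inE.
have dirac_var d (T : measurableType d) (P : probability T R) (Z : T -> R) :
    measurable_fun setT Z ->
    (forall B, measurable B -> P (Z @^-1` B) = \d_(0 : R) B) -> ('V_P[Z] = 0)%E.
  move=> mZ HZ; rewrite -(variance_cst P 0).
  apply: same_law_variance => // B mB; rewrite HZ//.
  have [B0|B0] := pselect (B 0).
    rewrite (_ : cst (0 : R) @^-1` B = setT) ?probability_setT ?diracE ?mem_set//.
    by apply/seteqP; split.
  rewrite (_ : cst (0 : R) @^-1` B = set0) ?measure0 ?diracE ?memNset//.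
  by apply/seteqP; split.
(* A zero variance would produce an atom of mass 1, but a normal law is dominated by Lebesgue
   measure and has no atoms. *)
have normal_var d (T : measurableType d) (P : probability T R) (Z : T -> R) r :
    r != 0 -> measurable_fun setT Z ->
    (forall B, measurable B -> P (Z @^-1` B) = normal_prob 0 r B) ->
    ('V_P[Z] != 0)%E.
  move=> r0 mZ HZ; apply/eqP => /(variance0_ae mZ)[c].
  rewrite HZ//.
  rewrite (_ : normal_prob 0 r [set c] = 0%E).
    by move/eqP; rewrite eqe eq_sym oner_eq0.
  have /null_content_dominatesP := @normal_prob_dominates R 0 r.
  by apply => //; exact: lebesgue_measure_set1.
move=> B mB; rewrite Xs// Yt//.
case: ifPn => s0; case: ifPn => t0 //.
- exfalso; move: VXY; rewrite (dirac_var _ _ P1)//; last first.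
    by move=> C mC; rewrite Xs// s0.
  move/esym/eqP; apply/negP; apply: (normal_var _ _ _ _ _ t0 mY) => C mC.
  by rewrite Yt// (negbTE t0).
- exfalso; move: VXY; rewrite [RHS](dirac_var _ _ P2)//; last first.
    by move=> C mC; rewrite Yt// t0.
  move/eqP; apply/negP; apply: (normal_var _ _ _ _ _ s0 mX) => C mC.
  by rewrite Xs// (negbTE s0).
have abs r : normal_prob 0 r = normal_prob 0 `|r|.
  by case: (ger0P r) => _ //; rewrite normal_probN.
suff st : `|s| = `|t| by rewrite abs st -abs.
have {}Xs C : measurable C -> P1 (X @^-1` C) = normal_prob 0 s C.
  by move=> mC; rewrite Xs// (negbTE s0).
have VX0 := normal_var _ _ _ _ _ s0 mX Xs.
set k := `|t| / `|s|.
have k0 : 0 < k by rewrite divr_gt0 ?normr_gt0.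
have : ('V_P1[(k \o* X)%R] = 'V_P2[Y])%E.
  apply: same_law_variance => //.
    exact: measurable_funM.
  move=> C mC; rewrite Yt// (negbTE t0).
  have -> : (k \o* X) @^-1` C = X @^-1` ((fun x => k * x) @^-1` C).
    by apply/seteqP; split => w /=; rewrite mulrC.
  rewrite Xs; last first.
    by rewrite -[_ @^-1` C]setTI; apply: measurable_funM.
  by rewrite normal_prob_scale// abs normrM (gtr0_norm k0) divfK ?normr_eq0// -abs.
rewrite varianceZ// -VXY.
move: VX0; have /fineK <- := variance_fin_num X2.
rewrite eqe => VX0 [] /eqP; rewrite -[eqbRHS]mul1r (inj_eq (mulIf VX0)).
rewrite sqrf_eq1 => /orP[/eqP k1|/eqP kN1].
  by rewrite -[LHS]mul1r -k1 divfK// normr_eq0.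
by move: k0; rewrite kN1 oppr_gt0 ltr10.
Qed.

(** * The Cramer-Wold theorem *)

Lemma bounded_Lfun1 (R : realType) d (T : measurableType d) (P : probability T R)
    (f : T -> R) (M : R) :
  measurable_fun setT f -> (forall w, `|f w| <= M) -> f \in Lfun P 1.
Proof.
move=> mf fM; apply/Lfun1_integrable/measurable_bounded_integrable => //.
  by rewrite (le_lt_trans (probability_le1 _ _)) ?ltry.
exists M; split; first exact: num_real.
by move=> K MK w _ /=; rewrite (le_trans (fM w))// ltW.
Qed.

Lemma bounded_cvg_expectation (R : realType) d (T : measurableType d)
    (P : probability T R) (f_ : nat -> T -> R) (f : T -> R) (M : R) :
  (forall n, measurable_fun setT (f_ n)) -> (forall n w, `|f_ n w| <= M) ->
  (forall w, f_ n w @[n --> \oo] --> f w) ->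
  ('E_P[f_ n])%E @[n --> \oo] --> ('E_P[f])%E.
Proof.
move=> mf fM ff; rewrite unlock.
apply: (@dominated_cvg _ _ _ P setT measurableT _ _ (cst M%:E)) => //.
- by move=> n; exact/measurable_EFinP.
- by move=> w _; apply/cvg_EFin; [exact: nearW|exact: ff].
- by apply/finite_measure_integrable_cst.
- by move=> n w _; rewrite lee_fin.
Qed.

Lemma measurable_linear (R : realType) (n : nat) d (T : measurableType d)
    (Z : T -> 'cV[R]_n) (a : 'rV[R]_n) :
  (forall i, measurable_fun setT (fun w => Z w i 0)) ->
  measurable_fun setT (fun w => (a *m Z w) 0 0).
Proof.
move=> mZ; under eq_fun do rewrite mxE.
by apply: measurable_sum => i; exact: measurable_funM.
Qed.

Section sign_step.
Context (R : realType).

(* Its iterates converge to the sign on [-1, 1], and they are polynomials, so that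
   they turn a cosine into a limit of trigonometric polynomials. *)
Definition sign_step (u : R) : R := (3 * u - u ^+ 3) / 2.

Lemma sign_stepN u : sign_step (- u) = - sign_step u.
Proof. by rewrite /sign_step; field. Qed.

Lemma iter_sign_stepN k u : iter k sign_step (- u) = - iter k sign_step u.
Proof. by elim: k => //= k ->; rewrite sign_stepN. Qed.

(** Each of [1 + sign_step u] and [1 - sign_step u] is a square times a factor that is positive on
    [-1, 1]. The double roots say that [sign_step] is stationary at its fixed points -1 and 1. *)
Lemma sign_step_le1 u : `|u| <= 1 -> `|sign_step u| <= 1.
Proof.
rewrite !ler_norml => /andP[u1 u2]; rewrite -subr_ge0 -[_ <= 1]subr_ge0.
have -> : sign_step u - -1 = (1 + u) ^+ 2 * (2 - u) / 2.
  by rewrite /sign_step; field.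
have -> : 1 - sign_step u = (1 - u) ^+ 2 * (2 + u) / 2.
  by rewrite /sign_step; field.
by rewrite !mulr_ge0 ?sqr_ge0//; lra.
Qed.

Lemma iter_sign_step_le1 k u : `|u| <= 1 -> `|iter k sign_step u| <= 1.
Proof. by move=> u1; elim: k => //= k; exact: sign_step_le1. Qed.

(** One step multiplies the distance [1 - y] to the fixed point 1 by [1 - y (1 + y) / 2]. The
    iterates never fall below [u], so this ratio is at most [1 - u / 2] throughout and the
    convergence is geometric. *)
Lemma iter_sign_step_bound u k : 0 <= u <= 1 ->
  u <= iter k sign_step u <= 1 /\ 1 - iter k sign_step u <= (1 - u / 2) ^+ k.
Proof.
move=> /andP[u0 u1]; elim: k => [|k [/andP[]]].
  by rewrite expr0 /= lexx u1; split => //; lra.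
rewrite iterS exprS; set y := iter k _ _; set q := _ ^+ k => uy y1 yq.
have yE : 1 - sign_step y = (1 - y * (1 + y) / 2) * (1 - y).
  by rewrite /sign_step; field.
have y0 : 0 <= y := le_trans u0 uy.
split; last by rewrite yE; apply: ler_pM => //; nra.
apply/andP; split.
  apply: le_trans uy _; rewrite -subr_ge0.
  have -> : sign_step y - y = y * ((1 - y) * (1 + y)) / 2.
    by rewrite /sign_step; field.
  by rewrite !mulr_ge0//; lra.
by rewrite -subr_ge0 yE mulr_ge0//; nra.
Qed.

Lemma cvg_iter_sign_step u : `|u| <= 1 ->
  iter k sign_step u @[k --> \oo] --> Num.sg u.
Proof.
have pos v : 0 < v -> v <= 1 -> iter k sign_step v @[k --> \oo] --> (1 : R).
  move=> v0 v1; have v01 : 0 <= v <= 1 by rewrite ltW.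
  apply: (@squeeze_cvgr _ _ _ _ (fun k => 1 - (1 - v / 2) ^+ k) (cst 1)).
  - apply: nearW => k; have [/andP[_ ->] h] := iter_sign_step_bound k v01.
    by rewrite andbT lerBlDr -lerBlDl.
  - rewrite -[X in _ --> X]subr0; apply: cvgB; first exact: cvg_cst.
    by apply: cvg_expr; rewrite ger0_norm; lra.
  - exact: cvg_cst.
rewrite ler_norml => /andP[uN1 u1]; have [u0|u0|->] := ltrgt0P u.
- by rewrite gtr0_sg//; exact: pos.
- rewrite ltr0_sg//.
  have -> : (fun k => iter k sign_step u) = (fun k => - iter k sign_step (- u)).
    by apply/funext => k; rewrite iter_sign_stepN opprK.
  by apply: cvgN; apply: pos; [rewrite oppr_gt0|rewrite lerNl].
- rewrite sgr0 (_ : (fun _ => _) = cst 0); first exact: cvg_cst.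
  by apply/funext => k /=; elim: k => //= k ->; rewrite /sign_step; field.
Qed.

End sign_step.
Arguments sign_step {R} u.

Section cramer_wold.
Context (R : realType) (n : nat).
Context d1 (T1 : measurableType d1) (P1 : probability T1 R) (X : T1 -> 'cV[R]_n).
Context d2 (T2 : measurableType d2) (P2 : probability T2 R) (Y : T2 -> 'cV[R]_n).
Hypothesis mX : forall i, measurable_fun setT (fun w => X w i 0).
Hypothesis mY : forall i, measurable_fun setT (fun w => Y w i 0).

(** The phase [b] puts sines and cosines into one family, whose products are again linear
    combinations of its members: a real substitute for the characters of the Fourier transform. *)
Definition wave (a : 'rV[R]_n) (b : R) (v : 'cV[R]_n) : R :=
  cos ((a *m v) 0 0 + b).

(** Measurability is required only after composition with [X] and [Y], so no sigma-algebra has to be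
    chosen on the space of vectors. *)
Definition bounded_measurable (F : 'cV[R]_n -> R) : Prop :=
  [/\ exists M, forall v, `|F v| <= M, measurable_fun setT (F \o X) &
      measurable_fun setT (F \o Y)].

(** In terms of measures: the laws of [X] and [Y], each weighted by the density [F], have the same
    Fourier transform. *)
Definition agree (F : 'cV[R]_n -> R) : Prop :=
  bounded_measurable F /\
  forall a b, ('E_P1[fun w => (F (X w) * wave a b (X w))%R] =
               'E_P2[fun w => (F (Y w) * wave a b (Y w))%R])%E.

(* Multipliers form an algebra that is closed under bounded pointwise limits and
   contains the cosines, hence the indicators of the half-spaces c < v_i; the sets
   whose indicator is a multiplier form a sigma-algebra, so no pi-lambda argument
   is needed. *)
Definition multiplier (g : 'cV[R]_n -> R) : Prop :=
  bounded_measurable g /\ forall F, agree F -> agree (fun v => F v * g v).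

Lemma measurable_wave d (T : measurableType d) (Z : T -> 'cV[R]_n) a b :
  (forall i, measurable_fun setT (fun w => Z w i 0)) ->
  measurable_fun setT (fun w => wave a b (Z w)).
Proof.
move=> mZ; apply: (@measurableT_comp _ _ _ _ _ _ cos).
  by apply: continuous_measurable_fun; exact: continuous_cos.
by apply: measurable_funD => //; exact: measurable_linear.
Qed.

Lemma bounded_measurable_wave a b : bounded_measurable (wave a b).
Proof.
split; [|exact: measurable_wave|exact: measurable_wave].
by exists 1 => v; rewrite ler_norml cos_geN1 cos_le1.
Qed.

Lemma bounded_measurableM F G : bounded_measurable F -> bounded_measurable G ->
  bounded_measurable (fun v => F v * G v).
Proof.
move=> [[M FM] mFX mFY] [[K GK] mGX mGY]; split.
- by exists (M * K) => v; rewrite normrM ler_pM.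
- exact: measurable_funM.
- exact: measurable_funM.
Qed.

Lemma bounded_measurableD F G : bounded_measurable F -> bounded_measurable G ->
  bounded_measurable (fun v => F v + G v).
Proof.
move=> [[M FM] mFX mFY] [[K GK] mGX mGY]; split.
- by exists (M + K) => v; rewrite (le_trans (ler_normD _ _))// lerD.
- exact: measurable_funD.
- exact: measurable_funD.
Qed.

Lemma bounded_measurable_cst c : bounded_measurable (fun=> c).
Proof. by split; [exists `|c| => _|exact: measurable_cst|exact: measurable_cst]. Qed.

Lemma bounded_measurable_lim (g_ : nat -> 'cV[R]_n -> R) g (M : R) :
  (forall k, bounded_measurable (g_ k)) -> (forall k v, `|g_ k v| <= M) ->
  (forall v, g_ k v @[k --> \oo] --> g v) -> bounded_measurable g.
Proof.
move=> bg gM gg; split.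
- exists M => v; have /cvg_norm gv := gg v.
  rewrite -(cvg_lim _ gv)//; apply: limr_le; first by apply/cvg_ex; exists `|g v|.
  exact: nearW.
- by apply: (@measurable_fun_cvg _ _ _ _ (fun k => g_ k \o X)) => [k|w _];
    [case: (bg k)|exact: gg].
- by apply: (@measurable_fun_cvg _ _ _ _ (fun k => g_ k \o Y)) => [k|w _];
    [case: (bg k)|exact: gg].
Qed.

Lemma bounded_measurable_Lfun F : bounded_measurable F ->
  F \o X \in Lfun P1 1 /\ F \o Y \in Lfun P2 1.
Proof.
move=> [[M FM] mFX mFY].
by split; apply: bounded_Lfun1 => // w; exact: FM.
Qed.

Lemma agreeD F G : agree F -> agree G -> agree (fun v => F v + G v).
Proof.
move=> [bF EF] [bG EG]; split; first exact: bounded_measurableD.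
move=> a b; have bw := bounded_measurable_wave a b.
have [FX FY] := bounded_measurable_Lfun (bounded_measurableM bF bw).
have [GX GY] := bounded_measurable_Lfun (bounded_measurableM bG bw).
under eq_fun do rewrite mulrDl; rewrite (expectationD FX GX) EF EG.
by under [in RHS]eq_fun do rewrite mulrDl; rewrite (expectationD FY GY).
Qed.

Lemma agreeZ c F : agree F -> agree (fun v => F v * c).
Proof.
move=> [bF EF]; split.
  by apply: bounded_measurableM => //; exact: bounded_measurable_cst.
move=> a b; have bw := bounded_measurable_wave a b.
have [FX FY] := bounded_measurable_Lfun (bounded_measurableM bF bw).
under eq_fun do rewrite mulrAC; rewrite (expectationZl c FX) EF.
by under [in RHS]eq_fun do rewrite mulrAC; rewrite (expectationZl c FY).
Qed.

Lemma agree_lim F_ F M : (forall k, agree (F_ k)) -> (forall k v, `|F_ k v| <= M) ->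
  (forall v, F_ k v @[k --> \oo] --> F v) -> agree F.
Proof.
move=> aF FM FF; split.
  by apply: bounded_measurable_lim FM FF => k; case: (aF k).
move=> a b.
have cX : ('E_P1[fun w => (F_ k (X w) * wave a b (X w))%R])%E @[k --> \oo] -->
    ('E_P1[fun w => (F (X w) * wave a b (X w))%R])%E.
  apply: (@bounded_cvg_expectation _ _ _ P1 _ _ M).
  - move=> k; have [bF _] := aF k.
    by case: (bounded_measurableM bF (bounded_measurable_wave a b)).
  - move=> k w; rewrite normrM -[M]mulr1 ler_pM//.
    by rewrite ler_norml cos_geN1 cos_le1.
  - by move=> w; apply: cvgM; [exact: FF|exact: cvg_cst].
have cY : ('E_P2[fun w => (F_ k (Y w) * wave a b (Y w))%R])%E @[k --> \oo] -->
    ('E_P2[fun w => (F (Y w) * wave a b (Y w))%R])%E.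
  apply: (@bounded_cvg_expectation _ _ _ P2 _ _ M).
  - move=> k; have [bF _] := aF k.
    by case: (bounded_measurableM bF (bounded_measurable_wave a b)).
  - move=> k w; rewrite normrM -[M]mulr1 ler_pM//.
    by rewrite ler_norml cos_geN1 cos_le1.
  - by move=> w; apply: cvgM; [exact: FF|exact: cvg_cst].
have XYk : (fun k => 'E_P1[fun w => (F_ k (X w) * wave a b (X w))%R])%E =
    (fun k => 'E_P2[fun w => (F_ k (Y w) * wave a b (Y w))%R])%E.
  by apply/funext => k; exact: (aF k).2.
by rewrite XYk in cX; exact: cvg_unique cX cY.
Qed.

Lemma multiplier_cst c : multiplier (fun=> c).
Proof.
by split=> [|F]; [exact: bounded_measurable_cst|exact: agreeZ].
Qed.

Lemma multiplierD g h : multiplier g -> multiplier h ->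
  multiplier (fun v => g v + h v).
Proof.
move=> [bg mg] [bh mh]; split=> [|F aF]; first exact: bounded_measurableD.
by under eq_fun do rewrite mulrDr; apply: agreeD; [exact: mg|exact: mh].
Qed.

Lemma multiplierM g h : multiplier g -> multiplier h ->
  multiplier (fun v => g v * h v).
Proof.
move=> [bg mg] [bh mh]; split=> [|F aF]; first exact: bounded_measurableM.
by under eq_fun do rewrite mulrA; apply: mh; exact: mg.
Qed.

(** By [cos A cos B = (cos (A + B) + cos (A - B)) / 2], multiplying by a wave merely shifts the
    frequency and phase of the test wave, and [agree] quantifies over all of these. *)
Lemma multiplier_wave a b : multiplier (wave a b).
Proof.
split=> [|F [bF EF]]; first exact: bounded_measurable_wave.
split; first exact: bounded_measurableM (bounded_measurable_wave a b).
move=> a' b'.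
have prod v : F v * wave a b v * wave a' b' v =
    (F v * wave (a + a') (b + b') v) * 2^-1 +
    (F v * wave (a - a') (b - b') v) * 2^-1.
  rewrite -mulrDl -mulrDr -!mulrA; congr (_ * _).
  rewrite /wave !mulmxDl mulNmx !mxE.
  set s := \sum_j _; set t := \sum_j _.
  rewrite (_ : s + t + (b + b') = (s + b) + (t + b')); last by ring.
  rewrite (_ : s - t + (b - b') = (s + b) - (t + b')); last by ring.
  by move: (s + b) (t + b') => A B; rewrite cosD cosB; field.
have bw c e := bounded_measurableM bF (bounded_measurable_wave c e).
have [pX pY] := bounded_measurable_Lfun (bw (a + a') (b + b')).
have [mX' mY'] := bounded_measurable_Lfun (bw (a - a') (b - b')).
under eq_fun do rewrite prod.
rewrite expectationD; [|exact: Lfun_scale|exact: Lfun_scale].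
rewrite (expectationZl _ pX) (expectationZl _ mX') !EF.
under [in RHS]eq_fun do rewrite prod.
rewrite expectationD; [|exact: Lfun_scale|exact: Lfun_scale].
by rewrite (expectationZl _ pY) (expectationZl _ mY').
Qed.

Lemma multiplier_lim g_ g : (forall k, multiplier (g_ k)) ->
  (forall k v, `|g_ k v| <= 1) ->
  (forall v, g_ k v @[k --> \oo] --> g v) -> multiplier g.
Proof.
move=> mg g1 gg; split.
  by apply: bounded_measurable_lim g1 gg => k; case: (mg k).
move=> F aF; have [[[M FM] _ _] _] := aF.
apply: (@agree_lim (fun k v => F v * g_ k v) _ M).
- by move=> k; apply: (mg k).2.
- by move=> k v; rewrite normrM -[M]mulr1 ler_pM.
- by move=> v; apply: cvgM; [exact: cvg_cst|exact: gg].
Qed.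

Lemma multiplier_iter g k :
  multiplier g -> multiplier (fun v => iter k sign_step (g v)).
Proof.
move=> mg; elim: k => //= k mk.
rewrite (_ : (fun _ => _) = fun v : 'cV[R]_n => 3 / 2 * iter k sign_step (g v) +
    - 2^-1 * (iter k sign_step (g v) *
      (iter k sign_step (g v) * iter k sign_step (g v)))).
  apply: multiplierD; apply: multiplierM; try exact: multiplier_cst => //.
    exact: mk.
  by apply: multiplierM => //; exact: multiplierM.
by apply/funext => v; rewrite /sign_step; field.
Qed.

(** A sine is a wave delayed by a quarter period, whence the [pi / 2] in the phase; the iterates of
    [sign_step] turn it into a square wave centred at [c]. The period grows with [m], which serves
    to remove the periodicity in the limit. *)
Lemma multiplier_sg_sin i c m :
  multiplier (fun v => Num.sg (sin ((v i 0 - c) / m.+1%:R))).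
Proof.
set a : 'rV[R]_n := m.+1%:R^-1 *: delta_mx 0 i.
set b : R := - (c / m.+1%:R) - pi / 2.
have sin_wave (v : 'cV[R]_n) : sin ((v i 0 - c) / m.+1%:R) = wave a b v.
  rewrite /wave /a /b -scalemxAl -rowE !mxE addrA cosBpihalf; congr sin.
  by rewrite mulrBl mulrC.
apply: (multiplier_lim (fun k => multiplier_iter k (multiplier_wave a b)))
  => [k v|v].
  by apply: iter_sign_step_le1; rewrite ler_norml cos_geN1 cos_le1.
rewrite sin_wave; apply: cvg_iter_sign_step.
by rewrite ler_norml cos_geN1 cos_le1.
Qed.

(** For a fixed [v], as soon as [|v i 0 - c| < pi * (m + 1)] the sine has the sign of [v i 0 - c],
    so the square waves are eventually constant in [m]. The combination [(sg + sg^2) / 2] of the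
    limit takes the value 0 at [v i 0 = c], as a strict inequality demands. *)
Lemma multiplier_ray i (c : R) : multiplier (fun v => (c < v i 0)%R%:R).
Proof.
have sgE (x : R) : (0 < x)%R%:R = 2^-1 * (Num.sg x + Num.sg x * Num.sg x).
  case: (ltrgt0P x) => [x0|x0|->].
  - by rewrite gtr0_sg//= mulr1n; field.
  - by rewrite ltr0_sg//= mulr0n; field.
  - by rewrite sgr0 /= mulr0n; field.
have msg : multiplier (fun v => Num.sg (v i 0 - c)).
  apply: (multiplier_lim (multiplier_sg_sin i c)) => [k v|v].
    by rewrite normr_sg; case: eqP.
  apply: cvg_near_cst; near=> m.
  have m0 : 0 < m.+1%:R :> R by [].
  have vm : `|v i 0 - c| / m.+1%:R < pi.
    rewrite ltr_pdivrMr// mulrC -ltr_pdivrMr ?pi_gt0//.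
    rewrite (@lt_le_trans _ _ m%:R)// ?ler_nat//.
    by near: m; exact: nbhs_infty_gtr.
  have [x0|x0|->] := ltrgt0P (v i 0 - c).
  - rewrite gtr0_sg ?gtr0_sg//; apply: sin_gt0_pi.
    by rewrite divr_gt0//= -[X in X / _](gtr0_norm x0).
  - rewrite (ltr0_sg x0) ltr0_sg// -[X in X / _]opprK mulNr sinN oppr_lt0.
    apply: sin_gt0_pi.
    by rewrite divr_gt0 ?oppr_gt0//= -(ltr0_norm x0).
  - by rewrite mul0r sin0 sgr0.
rewrite (_ : (fun _ => _) = fun v : 'cV[R]_n => 2^-1 *
    (Num.sg (v i 0 - c) + Num.sg (v i 0 - c) * Num.sg (v i 0 - c))).
  apply: multiplierM; first exact: multiplier_cst.
  by apply: multiplierD => //; exact: multiplierM.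
by apply/funext => v; rewrite -sgE subr_gt0.
Unshelve. all: by end_near.
Qed.

(** Complements are [1 - \1_B] and intersections are products, which gives finite unions; at each
    point the indicators of the partial unions are eventually constant, so countable unions are
    limits of multipliers. *)
Lemma multiplier_sigma_algebra : sigma_algebra setT [set B | multiplier (\1_B)].
Proof.
have setC B : multiplier \1_B -> multiplier (\1_(~` B)).
  move=> mB; rewrite (_ : \1_(~` B) = fun v : 'cV[R]_n => 1 + (- 1) * \1_B v).
    by apply: multiplierD; [|apply: multiplierM => //]; exact: multiplier_cst.
  apply/funext => v; rewrite !indicE in_setC.
  by case: (v \in B); rewrite /= ?mulr1 ?mulr0 ?subrr ?addr0.
have setI A B : multiplier \1_A -> multiplier \1_B -> multiplier (\1_(A `&` B)).
  move=> mA mB; rewrite (_ : \1_(A `&` B) = fun v : 'cV[R]_n => \1_A v * \1_B v).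
    exact: multiplierM.
  by apply/funext => v; rewrite indicI.
split=> /=.
- rewrite (_ : \1_set0 = fun=> 0); first exact: multiplier_cst.
  by apply/funext => v; rewrite indic0.
- by move=> B mB; rewrite setTD; exact: setC.
move=> B mB; pose U k := \big[setU/set0]_(j < k) B j.
have mU k : multiplier (\1_(U k)).
  elim: k => [|k IH]; rewrite /U.
    rewrite big_ord0 (_ : \1_set0 = fun=> 0); first exact: multiplier_cst.
    by apply/funext => v; rewrite indic0.
  rewrite big_ord_recr/= -[X in \1_X]setCK setCU.
  exact: (setC _ (setI _ _ (setC _ IH) (setC _ (mB k)))).
apply: (multiplier_lim mU) => [k v|v].
  by rewrite indicE; case: (_ \in _); rewrite ?normr0 ?normr1 ?ler01.
apply: cvg_near_cst.
have [[k _ Bkv]|nBv] := pselect ((\bigcup_k B k) v).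
  exists k.+1 => // j /= kj; rewrite !indicE !mem_set//; first by exists k.
  by rewrite /U -bigcup_mkord; exists k.
apply: nearW => j; rewrite !indicE !memNset//.
by rewrite /U -bigcup_mkord => -[k _ Bkv]; apply: nBv; exists k.
Qed.

(** The hypothesis enters by showing that the constant 1 agrees. Multiplying it by the indicator of
    [B] and testing against [wave 0 0], which is identically 1, reads off the two probabilities of
    [B]. *)
Lemma cramer_wold :
  (forall a : 'rV[R]_n,
     same_law P1 (fun w => (a *m X w) 0 0) P2 (fun w => (a *m Y w) 0 0)) ->
  same_distribution P1 X P2 Y.
Proof.
move=> XY B; set coord := fun (i : 'I_n) => _.
have agree1 : agree (fun=> 1).
  split=> [|a b]; first exact: bounded_measurable_cst.
  apply: (@same_law_expectation _ _ _ P1 _ _ P2 _ _ _ _ (XY a)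
    (fun t => 1 * cos (t + b))); [exact: measurable_linear|exact: measurable_linear|].
  apply: measurable_funM => //; apply: (@measurableT_comp _ _ _ _ _ _ cos).
    by apply: continuous_measurable_fun; exact: continuous_cos.
  exact: measurable_funD.
have coordB i (A : set R) : measurable A -> multiplier (\1_(coord i @^-1` A)).
  have rays : <<s @RGenOInfty.G R >> `<=`
      image_set_system setT (coord i) [set B | multiplier (\1_B)].
    apply: smallest_sub.
      exact/sigma_algebra_image/multiplier_sigma_algebra.
    move=> _ [c ->]; rewrite /image_set_system/= setTI.
    rewrite (_ : \1_ _ = fun v : 'cV[R]_n => (c < v i 0)%R%:R).
      exact: multiplier_ray.
    apply/funext => v; rewrite indicE; congr (nat_of_bool _)%:R.
    by apply/idP/idP => [/set_mem|h]; [|apply/mem_set]; rewrite /= in_itv/= andbT.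
  move=> mA; have /rays : (@RGenOInfty.G R).-sigma.-measurable A.
    by rewrite -RGenOInfty.measurableE; exact: mA.
  by rewrite /image_set_system/= setTI.
have sub : g_sigma_preimage coord `<=` [set B | multiplier (\1_B)].
  apply: smallest_sub; first exact: multiplier_sigma_algebra.
  apply: (big_ind (fun S => S `<=` [set B | multiplier (\1_B)])) => //.
    by move=> S1 S2 h1 h2 A [/h1|/h2].
  by move=> i _ _ [A mA <-]; rewrite setTI; exact: coordB.
move=> /sub[[_ mBX mBY] mB]; have [_ /(_ 0 0)] := mB _ agree1.
have indicE_wave d (T : measurableType d) (P : probability T R) (Z : T -> 'cV[R]_n) :
    measurable_fun setT ((\1_B : 'cV[R]_n -> R) \o Z) ->
    ('E_P[fun w => (1 * \1_B (Z w) * wave 0 0 (Z w))%R])%E = P (Z @^-1` B).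
  move=> mBZ; rewrite -expectation_indic; last exact/(measurable_indicP R).
  congr expectation; apply/funext => w.
  by rewrite /wave mul0mx mxE addr0 cos0 mulr1 mul1r !indicE.
by rewrite !indicE_wave.
Qed.

End cramer_wold.

(** * Gaussian vectors *)

Section second_moments.
Context (R : realType) d (T : measurableType d) (P : probability T R).

Lemma Lfun2_sqr (f : T -> R) : measurable_fun setT f ->
  (\int[P]_w (f w ^+ 2)%:E < +oo)%E -> f \in Lfun P 2%:E.
Proof.
move=> mf f2; rewrite inE; apply/andP; split; rewrite inE//=.
rewrite /finite_norm unlock poweR_lty//.
apply: le_lt_trans f2; apply: ge0_le_integral => //=.
- apply/measurable_EFinP; apply: (measurableT_comp (measurable_powR _)).
  exact: measurableT_comp.
- by apply/measurable_EFinP; exact: measurable_funX.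
- by move=> w _; rewrite lee_fin powR_mulrn// -normrX ger0_norm ?sqr_ge0.
Qed.

(** [has_covariance] asserts only finite values, so square integrability has to be recovered: a
    finite variance puts [X - c] in L2 for the real centring constant [c], and constants lie in
    L2. *)
Lemma variance_lty_Lfun2 (X : T -> R) : measurable_fun setT X ->
  ('V_P[X] < +oo)%E -> X \in Lfun P 2%:E.
Proof.
move=> mX; rewrite /variance covariance.unlock; set c := fine _ => Vfin.
rewrite (_ : X = (X \- cst c) + cst c); last first.
  by apply/funext => w; rewrite !fctE/= subrK.
apply: rpredD => [|h|h]; [by rewrite lee1n| |exact: Lfun_cst].
apply: Lfun2_sqr; first exact: measurable_funB.
by apply: le_lt_trans Vfin; rewrite unlock.
Qed.

Lemma covariance_suml (I : Type) (s : seq I) (a : I -> R) (X : I -> T -> R)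
    (Y : T -> R) (r : I -> R) :
  (forall i, X i \in Lfun P 2%:E) -> Y \in Lfun P 2%:E ->
  (forall i, covariance P (X i) Y = (r i)%:E) ->
  (fun w => \sum_(i <- s) a i * X i w) \in Lfun P 2%:E /\
  covariance P (fun w => \sum_(i <- s) a i * X i w) Y =
    (\sum_(i <- s) a i * r i)%:E.
Proof.
have Pfin : P setT \is a fin_num by exact: fin_num_measure.
move=> X2 Y2 XY; elim: s => [|i s [s2 IH]].
  under eq_fun do rewrite big_nil; rewrite big_nil.
  by split; [exact: Lfun_cst|exact: covariance_cst_l].
have iE : (fun w => \sum_(j <- i :: s) a j * X j w) =
    (a i \o* X i) \+ (fun w => \sum_(j <- s) a j * X j w).
  by apply/funext => w; rewrite big_cons/= mulrC.
have aX2 : (a i \o* X i) \in Lfun P 2%:E by apply: Lfun_scale => //; rewrite ler1n.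
rewrite iE big_cons; split; first by apply: rpredD => //; rewrite lee1n.
rewrite covarianceDl// IH covarianceZl ?XY//.
- exact: Lfun_subset12.
- exact: Lfun_subset12.
- exact: Lfun2_mul_Lfun1.
Qed.

Context (n : nat) (Z : T -> 'cV[R]_n) (S : 'M[R]_n).
Hypothesis mZ : forall i, measurable_fun setT (fun w => Z w i 0).
Hypothesis ZS : has_covariance P Z S.

Lemma has_covariance_Lfun2 i : (fun w => Z w i 0) \in Lfun P 2%:E.
Proof. by apply: variance_lty_Lfun2 => //; rewrite /variance ZS ltry. Qed.

Lemma linear_Lfun2 (a : 'rV[R]_n) : (fun w => (a *m Z w) 0 0) \in Lfun P 2%:E.
Proof.
under eq_fun do rewrite mxE.
(* The partner [cst 0] is a dummy: only the membership in L2 is wanted here. *)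
have [] := @covariance_suml _ (index_enum 'I_n) (a 0) (fun i w => Z w i 0)
  (cst 0) (fun=> 0) _ _ _ => //.
- exact: has_covariance_Lfun2.
- exact: Lfun_cst.
- by move=> i; exact: covariance_cst_r.
Qed.

Lemma covariance_linear (a b : 'rV[R]_n) :
  covariance P (fun w => (a *m Z w) 0 0) (fun w => (b *m Z w) 0 0) =
  ((a *m S *m b^T) 0 0)%:E.
Proof.
have L2 := has_covariance_Lfun2.
have step (c : 'rV[R]_n) (Y : T -> R) (r : 'I_n -> R) : Y \in Lfun P 2%:E ->
    (forall i, covariance P (fun w => Z w i 0) Y = (r i)%:E) ->
    covariance P (fun w => (c *m Z w) 0 0) Y = (\sum_i c 0 i * r i)%:E.
  move=> Y2 XY; under eq_fun do rewrite mxE.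
  by have [] := @covariance_suml _ (index_enum _) (c 0) (fun i w => Z w i 0)
    Y r L2 Y2 XY.
rewrite (step _ _ (fun i => (S *m b^T) i 0)); first last.
- move=> i; rewrite covarianceC (step _ _ (fun j => S j i)) => [|//|j]; last exact: ZS.
  congr EFin; rewrite mxE; apply: eq_bigr => j _.
  rewrite mxE mulrC; congr (_ * _); apply: EFin_inj.
  by rewrite -!ZS covarianceC.
- exact: linear_Lfun2.
by rewrite -mulmxA [in RHS]mxE.
Qed.

End second_moments.

Section linear_image.
Context (R : realType) d (T : measurableType d) (P : probability T R).
Context (n : nat) (Z : T -> 'cV[R]_n) (A : 'M[R]_n).

Lemma centered_gaussian_linear :
  centered_gaussian P Z -> centered_gaussian P (fun w => A *m Z w).
Proof.
move=> [mZ gZ]; split=> [i|a]; last by under eq_fun do rewrite mulmxA; exact: gZ.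
have E w : (A *m Z w) i 0 = (row i A *m Z w) 0 0 by rewrite -row_mul [RHS]mxE.
by under eq_fun do rewrite E; exact: measurable_linear.
Qed.

Lemma has_covariance_linear S :
  (forall i, measurable_fun setT (fun w => Z w i 0)) ->
  has_covariance P Z S -> has_covariance P (fun w => A *m Z w) (A *m S *m A^T).
Proof.
move=> mZ ZS i j.
have E k : (fun w => (A *m Z w) k 0) = (fun w => (row k A *m Z w) 0 0).
  by apply/funext => w; rewrite -row_mul [RHS]mxE.
rewrite !E (covariance_linear mZ ZS) -row_mul; congr EFin.
rewrite [LHS]mxE [RHS]mxE; apply: eq_bigr => k _.
by congr (_ * _); [rewrite [LHS]mxE|rewrite !mxE].
Qed.

Lemma has_covariance_unique S S' :
  has_covariance P Z S -> has_covariance P Z S' -> S = S'.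
Proof.
by move=> ZS ZS'; apply/matrixP => i j; apply: EFin_inj; rewrite -ZS -ZS'.
Qed.

Lemma has_covariance_sym S : has_covariance P Z S -> S^T = S.
Proof.
move=> ZS; apply/matrixP => i j; rewrite mxE; apply: EFin_inj.
by rewrite -!ZS covarianceC.
Qed.

End linear_image.

(** Polarization of the difference [D]: basis vectors show that its diagonal vanishes, and then the
    sum of the basis vectors [i] and [j] leaves [2 D i j = 0]. *)
Lemma sym_quadratic_form_inj (R : numFieldType) (n : nat) (S S' : 'M[R]_n) :
  S^T = S -> S'^T = S' ->
  (forall a : 'rV[R]_n, a *m S *m a^T = a *m S' *m a^T) -> S = S'.
Proof.
move=> sS sS' SS'; apply/eqP; rewrite -subr_eq0; apply/eqP; set D := S - S'.
have sD : D^T = D by rewrite linearB/= sS sS'.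
have D0 (a : 'rV_n) : a *m D *m a^T = 0 by rewrite /D mulmxBr mulmxBl SS' subrr.
clearbody D.
have E (i j : 'I_n) : delta_mx (0 : 'I_1) i *m D *m (delta_mx 0 j)^T = (D i j)%:M.
  by rewrite -rowE trmx_delta -colE; apply/matrixP => k l; rewrite !ord1 !mxE.
apply/matrixP => i j; rewrite [RHS]mxE.
have := D0 (delta_mx 0 i + delta_mx 0 j).
have -> : (delta_mx 0 i + delta_mx 0 j : 'rV[R]_n)^T =
    (delta_mx 0 i)^T + (delta_mx 0 j)^T.
  exact: linearD.
rewrite !mulmxDl !mulmxDr !E.
have diag k : D k k = 0.
  by have /matrixP/(_ 0 0) := D0 (delta_mx 0 k); rewrite E !mxE.
rewrite !diag => /matrixP/(_ 0 0); rewrite !mxE/= !mulr1n add0r addr0.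
have <- : D i j = D j i by rewrite -[in LHS]sD mxE.
by rewrite -mulr2n => /eqP; rewrite mulrn_eq0/= => /eqP.
Qed.

Lemma g_sigma_preimage_linear (R : realType) (n : nat) (a : 'rV[R]_n) (B : set R) :
  measurable B ->
  g_sigma_preimage (fun (i : 'I_n) (v : 'cV[R]_n) => v i 0 : R)
    ((fun v : 'cV[R]_n => (a *m v) 0 0) @^-1` B).
Proof.
move=> mB; rewrite /g_sigma_preimage; set G := bigop _ _ _.
have mcoord i : measurable_fun setT (fun v : g_sigma_algebraType G => v i 0 : R).
  move=> _ C mC; rewrite setTI; apply: sub_sigma_algebra.
  by rewrite /G (bigD1 i)//=; left; exists C => //; rewrite setTI.
have := measurable_linear a mcoord.
by move=> /(_ measurableT _ mB); rewrite setTI.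
Qed.

(** From laws to covariances, the variance of [a x] is the quadratic form of the covariance at [a],
    which determines a symmetric matrix. *)
Lemma gaussian_same_distribution (R : realType) (n : nat)
    d1 (T1 : measurableType d1) (P1 : probability T1 R) (X : T1 -> 'cV[R]_n)
    d2 (T2 : measurableType d2) (P2 : probability T2 R) (Y : T2 -> 'cV[R]_n) S S' :
  centered_gaussian P1 X -> has_covariance P1 X S ->
  centered_gaussian P2 Y -> has_covariance P2 Y S' ->
  same_distribution P1 X P2 Y <-> S = S'.
Proof.
move=> [mX gX] XS [mY gY] YS; split=> [XY|SS'].
  apply: (sym_quadratic_form_inj (has_covariance_sym XS)
    (has_covariance_sym YS)) => a.
  apply/matrixP => i j; rewrite !ord1; apply: EFin_inj.
  rewrite -(covariance_linear mX XS) -(covariance_linear mY YS).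
  apply: same_law_variance; [exact: measurable_linear|exact: measurable_linear|].
  move=> B mB; apply: (XY ((fun v : 'cV[R]_n => (a *m v) 0 0) @^-1` B)).
  exact: g_sigma_preimage_linear.
apply: cramer_wold => // a.
apply: eq_variance_same_law => //;
  [exact: linear_Lfun2 XS _|exact: linear_Lfun2 YS _|].
by rewrite /variance (covariance_linear mX XS) (covariance_linear mY YS) SS'.
Qed.

(** * Block unitriangular matrices *)

Section block_unitriangular.
Context (R : fieldType) (d n : nat) (rho : 'I_n -> nat).
Implicit Types (A : 'I_n -> 'I_n -> 'M[R]_d) (Q : 'I_n -> 'M[R]_d).

(** A rank function expresses triangularity without permuting the blocks, which keep the order of
    stacking; an off-diagonal block [A i j] may be nonzero only if [rho i < rho j]. *)
Definition unitriangular A : Prop :=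
  (forall i, A i i = 1%:M) /\
  (forall i j, j != i -> (rho j <= rho i)%N -> A i j = 0).

Lemma mxdiag_unit Q : \mxdiag_i Q i \in unitmx -> forall i, Q i \in unitmx.
Proof.
move=> uQ i; pose D := invmx (\mxdiag_i Q i).
have : \mxdiag_i Q i *m D = 1%:M by exact: mulmxV.
rewrite -[D](submxblockK (p_ := fun _ : 'I_n => d) (q_ := fun _ : 'I_n => d)).
rewrite mul_mxdiag_mxblock -mxdiagZ => /(congr1 (fun B => submxblock B i i)).
by rewrite mxblockK submxblock_diag => /mulmx1_unit[].
Qed.

Lemma invmx_mxdiag Q : \mxdiag_i Q i \in unitmx ->
  invmx (\mxdiag_i Q i) = \mxdiag_i invmx (Q i).
Proof.
move=> uQ; have uQi := mxdiag_unit uQ.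
apply: (can_inj (mulKmx uQ)); rewrite mulmxV// mul_mxdiag_mxblock -mxdiagZ.
apply: eq_mxblock => i j; case: eqVneq => _; last by rewrite mulmx0.
by rewrite !conform_mx_id mulmxV.
Qed.

Lemma unitriangular_unit A : unitriangular A -> \mxblock_(i, j) A i j \in unitmx.
Proof.
move=> [A1 A0]; rewrite -row_free_unit; apply: inj_row_free => v.
rewrite -[v](submxrowK (q_ := fun _ : 'I_n => d)).
set u := submxrow v => uA; suff u0 i : u i = 0.
  by rewrite (_ : \mxrow_j u j = \mxrow_j 0); [exact: mxrow0|exact: eq_mxrow].
have [m] := ubnP (rho i); elim: m => // m IH in i *; rewrite ltnS => im.
move: uA; rewrite mul_mxrow_mxblock => /(congr1 (fun B => submxrow B i)).
rewrite mxrowK submxrow0 (bigD1 i)//= A1 mulmx1 big1 ?addr0// => j ji.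
have [/(leq_trans)/(_ im)/IH ->|ij] := ltnP (rho j) (rho i).
  by rewrite mul0mx.
by rewrite A0 ?mulmx0// eq_sym.
Qed.

Lemma submxblock_gram A Q i j : \mxdiag_i Q i \in unitmx ->
  submxblock ((\mxblock_(i, j) A i j)^T *m invmx (\mxdiag_i Q i) *m
    \mxblock_(i, j) A i j) i j =
  \sum_k (A k i)^T *m invmx (Q k) *m A k j.
Proof.
move=> uQ.
by rewrite invmx_mxdiag// tr_mxblock mul_mxblock_mxdiag mul_mxblock mxblockK.
Qed.

(** Strong induction on the rank of [i]. In the block [(i, j)] of the product, only the terms with
    [k = i] or [rho k < rho i] survive; the latter agree by induction and cancel, leaving
    [invmx (Q i) *m A i j] on each side. The case [j = i] yields [Q i], and then every [A i j]
    follows. *)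
Lemma unitriangular_gram_inj A A' Q Q' :
  unitriangular A -> unitriangular A' ->
  \mxdiag_i Q i \in unitmx -> \mxdiag_i Q' i \in unitmx ->
  (\mxblock_(i, j) A i j)^T *m invmx (\mxdiag_i Q i) *m \mxblock_(i, j) A i j =
  (\mxblock_(i, j) A' i j)^T *m invmx (\mxdiag_i Q' i) *m \mxblock_(i, j) A' i j ->
  forall i, Q i = Q' i /\ forall j, A i j = A' i j.
Proof.
move=> [A1 A0] [A'1 A'0] uQ uQ' gram i.
have [m] := ubnP (rho i); elim: m => // m IH in i *; rewrite ltnS => im.
have block j : invmx (Q i) *m A i j = invmx (Q' i) *m A' i j.
  have := congr1 (fun B => submxblock B i j) gram.
  rewrite !submxblock_gram// (bigD1 i)//= [RHS](bigD1 i)//= A1 A'1 trmx1 !mul1mx.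
  rewrite [X in _ + X = _](_ : _ =
    \sum_(k < n | k != i) (A' k i)^T *m invmx (Q' k) *m A' k j).
    exact: addIr.
  apply: eq_bigr => k ki; have [ik|ki'] := leqP (rho i) (rho k).
    by rewrite A0 1?eq_sym// A'0 1?eq_sym// trmx0 !mul0mx.
  by have [-> Ak] := IH k (leq_trans ki' im); rewrite !Ak.
have QQ' : Q i = Q' i.
  by apply: (inv_inj (@invmxK _ _)); have := block i; rewrite A1 A'1 !mulmx1.
split=> // j; have uQi := mxdiag_unit uQ i.
by apply: (can_inj (mulKVmx uQi)); have := block j; rewrite -QQ'.
Qed.

End block_unitriangular.

(** * The matrices of the models *)

Ltac eval_mulrb :=
  repeat match goal with
  | |- context [?A *+ (nat_of_bool ?b)] =>
      lazymatch b with true => fail | false => fail | _ => idtac end;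
      first [have -> : b = true by lia | have -> : b = false by lia]
  end; rewrite ?mulr1n ?mulr0n ?subr0 ?sub0r.

Ltac cyclic_lia := rewrite /cyc_pred /cyc_succ; repeat case: ifP => /eqP ?; lia.

Section model_matrices.
Context (R : realType) (d N : nat).
Hypothesis hN : (2 <= N)%N.
Implicit Types m : model R d.

Definition reciprocal m : bool := if m is Reciprocal _ _ _ then true else false.

(* An order of the times in which the equation at a time involves, apart from
   the value at that time, only values at later times. *)
Definition time_rank m (i : nat) : nat :=
  match m with
  | ForwardMarkov _ _ | ForwardCMF _ _ _ => (N - i)%N
  | BackwardMarkov _ _ | BackwardCML _ _ _ | Reciprocal _ _ _ => i
  | ForwardCML _ _ _ => if i == N then N else (N.-1 - i)%N
  | BackwardCMF _ _ _ => if i == 0%N then N else i.-1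
  end.

Definition noise_cov m : nat -> 'M[R]_d :=
  match m with
  | ForwardMarkov _ Q | BackwardMarkov _ Q | Reciprocal _ _ Q | ForwardCML _ _ Q
  | ForwardCMF _ _ Q | BackwardCML _ _ Q | BackwardCMF _ _ Q => Q
  end.

Lemma same_type_reciprocal m m' :
  same_type m m' -> reciprocal m = reciprocal m'.
Proof. by case: m m' => [? ?|? ?|? ? ?|? ? ?|? ? ?|? ? ?|? ? ?] []. Qed.

Lemma same_type_time_rank m m' :
  same_type m m' -> time_rank m = time_rank m'.
Proof. by case: m m' => [? ?|? ?|? ? ?|? ? ?|? ? ?|? ? ?|? ? ?] []. Qed.

(** Ranks decrease along the order in which the model generates a path; for [ForwardCML] this order
    is N, 0, 1, ..., N-1, and for [BackwardCMF] it is 0, N, N-1, ..., 1. *)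
Lemma stack_unitriangular m : ~~ reciprocal m ->
  unitriangular (fun i : 'I_N.+1 => time_rank m i)
    (fun i j : 'I_N.+1 => stack_block N m i j).
Proof.
move=> nr; split=> [i|i j].
  have := ltn_ord i; case: m nr => //= *; by eval_mulrb.
have := ltn_ord i; have := ltn_ord j; rewrite -val_eqE /=.
move: (nat_of_ord i) (nat_of_ord j) => {}i {}j.
case: m nr => //= [? ?|? ?|? ? ?|? ? ?|? ? ?|? ? ?] _ jN iN ji;
  do 2?[case: ifP => ?] => ij; first [by exfalso; lia | by eval_mulrb].
Qed.

Lemma Pmx_diag m : ~~ reciprocal m ->
  Pmx N m = \mxdiag_(i < N.+1) noise_cov m i.
Proof.
move=> nr; rewrite /Pmx /mxdiag; apply: eq_mxblock => i j.
have -> : cov_block N m i j = noise_cov m i *+ (j == i) by case: m nr.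
by rewrite eq_sym; case: eqVneq => // _; rewrite conform_mx_id.
Qed.

Lemma Tmx_unit m : constraints N m -> Tmx N m \in unitmx.
Proof.
case: (boolP (reciprocal m)) => [|nr _]; first by case: m => // Rm Rp R0 _ [].
exact: unitriangular_unit (stack_unitriangular nr).
Qed.

(** The boundary conditions are ordinary equations on the cycle of [N + 1 >= 3] times, where the
    predecessor and the successor of a time differ. So each block holds at most one coefficient, and
    the relations between [Rm] and [Rp] match it with the noise covariance. *)
Lemma Tmx_reciprocal (Rm Rp R0 : nat -> 'M[R]_d) :
  constraints N (Reciprocal Rm Rp R0) ->
  Tmx N (Reciprocal Rm Rp R0) = Pmx N (Reciprocal Rm Rp R0).
Proof.
move=> [RpE R0E _]; apply: eq_mxblock => i j /=.
have := ltn_ord i; have := ltn_ord j.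
move: (nat_of_ord i) (nat_of_ord j) => {}i {}j jN iN.
have [->|ji] := eqVneq j i.
  rewrite (_ : (i == cyc_pred N i) = false) 1?(_ : (i == cyc_succ N i) = false).
  - by rewrite mulr1n !mulr0n !subr0.
  - by cyclic_lia.
  - by cyclic_lia.
have [js|js] := eqVneq j (cyc_succ N i).
  rewrite (_ : (j == cyc_pred N i) = false).
    by rewrite mulr0n mulr1n subr0 sub0r.
  by move: js; cyclic_lia.
have -> : (i == cyc_succ N j) = (j == cyc_pred N i).
  by move: js; cyclic_lia.
case: eqP => [->|_]; last by rewrite !mulr0n !subr0.
rewrite !mulr0n mulr1n subr0 sub0r /cyc_pred; case: eqP => [->|i0].
  by rewrite R0E.
by rewrite RpE ?trmxK ?prednK//; lia.
Qed.

(** Needed at time 1 of [ForwardCMF] and time N-1 of [BackwardCML], where both coefficients multiply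
    the same value and the block is [- G - H] with [G = H]. *)
Lemma oppr_double_inj (A B : 'M[R]_d) : - A - A = - B - B -> A = B.
Proof.
move=> /eqP; rewrite -!opprD eqr_opp -!mulr2n -subr_eq0 -mulrnBl -scaler_nat.
by rewrite scaler_eq0 pnatr_eq0/= subr_eq0 => /eqP.
Qed.

Lemma same_blocks_parameters m m' :
  constraints N m -> constraints N m' -> same_type m m' -> ~~ reciprocal m ->
  (forall i, (i <= N)%N -> noise_cov m i = noise_cov m' i) ->
  (forall i j, (i <= N)%N -> (j <= N)%N ->
     stack_block N m i j = stack_block N m' i j) ->
  same_parameters N m m'.
Proof.
case: m => [M Q|M Q|//|G H Q|G H Q|G H Q|G H Q];
  case: m' => [M' Q'|M' Q'|//|G' H' Q'|G' H' Q'|G' H' Q'|G' H' Q'] //=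
  c c' _ _ QQ' TT'.
- split=> // k /= kN; have := TT' k k.-1 ltac:(lia) ltac:(lia).
  by eval_mulrb; exact: oppr_inj.
- split=> // k /= kN; have := TT' k k.+1 ltac:(lia) ltac:(lia).
  by eval_mulrb; exact: oppr_inj.
- split=> // k /= kN.
    have := TT' k k.-1 ltac:(lia) ltac:(lia).
    by eval_mulrb; exact: oppr_inj.
  have := TT' k N ltac:(lia) ltac:(lia).
  by eval_mulrb; exact: oppr_inj.
- have G1 : G 1%N = G' 1%N.
    have := TT' 1%N 0%N ltac:(lia) ltac:(lia).
    by eval_mulrb; rewrite -c -c'; exact: oppr_double_inj.
  have H1 : H 1%N = H' 1%N by rewrite -c -c'.
  split=> // k /= kN; have [->//|k1] := eqVneq k 1%N.
    have := TT' k k.-1 ltac:(lia) ltac:(lia).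
    by eval_mulrb; exact: oppr_inj.
  have := TT' k 0%N ltac:(lia) ltac:(lia).
  by eval_mulrb; exact: oppr_inj.
- have GN : G N.-1 = G' N.-1.
    have := TT' N.-1 N ltac:(lia) ltac:(lia).
    by eval_mulrb; rewrite -c -c'; exact: oppr_double_inj.
  have HN : H N.-1 = H' N.-1 by rewrite -c -c'.
  split=> // k /= kN; have [->//|k1] := eqVneq k N.-1.
    have := TT' k k.+1 ltac:(lia) ltac:(lia).
    by eval_mulrb; exact: oppr_inj.
  have := TT' k N ltac:(lia) ltac:(lia).
  by eval_mulrb; exact: oppr_inj.
- split=> // k /= kN.
    have := TT' k k.+1 ltac:(lia) ltac:(lia).
    by eval_mulrb; exact: oppr_inj.
  have := TT' k 0%N ltac:(lia) ltac:(lia).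
  by eval_mulrb; exact: oppr_inj.
Qed.

Lemma reciprocal_parameters (Rm Rp R0 Rm' Rp' R0' : nat -> 'M[R]_d) :
  (forall i j, (i <= N)%N -> (j <= N)%N ->
     stack_block N (Reciprocal Rm Rp R0) i j =
     stack_block N (Reciprocal Rm' Rp' R0') i j) ->
  same_parameters N (Reciprocal Rm Rp R0) (Reciprocal Rm' Rp' R0').
Proof.
move=> TT'; have pN k : (k <= N)%N -> (cyc_pred N k <= N)%N.
  by cyclic_lia.
have sN k : (k <= N)%N -> (cyc_succ N k <= N)%N.
  by cyclic_lia.
have pk k : (cyc_pred N k == k) = false by cyclic_lia.
have sk k : (cyc_succ N k == k) = false by cyclic_lia.
have ps k : (cyc_pred N k == cyc_succ N k) = false.
  by cyclic_lia.
split=> k /= kN.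
- have := TT' _ _ kN (pN _ kN); rewrite /=.
  rewrite pk ps eqxx !mulr0n !mulr1n !subr0 !sub0r.
  exact: oppr_inj.
- have := TT' _ _ kN (sN _ kN); rewrite /=.
  rewrite sk eq_sym ps eqxx !mulr0n !mulr1n !subr0 !sub0r.
  exact: oppr_inj.
- have := TT' _ _ kN kN; rewrite /=.
  by rewrite eqxx ![k == _]eq_sym pk sk !mulr0n !mulr1n !subr0.
Qed.

Definition precision m : 'M[R]_(\sum_(k < N.+1) d) :=
  (Tmx N m)^T *m invmx (Pmx N m) *m Tmx N m.

Lemma precision_parameters m m' : admissible N m -> admissible N m' ->
  same_type m m' -> precision m = precision m' ->
  [/\ same_parameters N m m', Tmx N m = Tmx N m' & Pmx N m = Pmx N m'].
Proof.
move=> [c [Psym _ uP]] [c' [Psym' _ uP']] mm' gram.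
have ordP (F F' : nat -> nat -> 'M[R]_d) :
    (forall i j : 'I_N.+1, F i j = F' i j) ->
    forall i j, (i <= N)%N -> (j <= N)%N -> F i j = F' i j.
  by move=> FF' i j iN jN; have := FF' (inord i) (inord j); rewrite !inordK.
case: (boolP (reciprocal m)) => [rm|nr].
  have rm' : reciprocal m' by rewrite -(same_type_reciprocal mm').
  case: m rm => // Rm Rp R0 _ in c Psym uP gram mm' *.
  case: m' rm' => // Rm' Rp' R0' _ in c' Psym' uP' gram mm' *.
  move: gram; rewrite /precision !Tmx_reciprocal// !Psym !Psym' !mulmxV//.
  rewrite !mul1mx => PP'.
  split => //; apply: reciprocal_parameters.
  apply: ordP => i j; move: PP'.
  by rewrite -!Tmx_reciprocal// /Tmx => /eq_mxblockP/(_ i j).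
have nr' : ~~ reciprocal m' by rewrite -(same_type_reciprocal mm').
have ut := stack_unitriangular nr.
have ut' : unitriangular (fun i : 'I_N.+1 => time_rank m i)
    (fun i j : 'I_N.+1 => stack_block N m' i j).
  by rewrite (same_type_time_rank mm'); exact: stack_unitriangular.
move: uP uP' gram; rewrite /precision !Pmx_diag// => uP uP'.
move=> /(unitriangular_gram_inj ut ut' uP uP') QT.
have TT (i j : 'I_N.+1) : stack_block N m i j = stack_block N m' i j.
  by have [_ ->] := QT i.
have QQ (i : 'I_N.+1) : noise_cov m i = noise_cov m' i by have [] := QT i.
split.
- apply: same_blocks_parameters => //; last exact: ordP.
  move=> i iN.
  by apply: (ordP (fun i _ => noise_cov m i) (fun i _ => noise_cov m' i) _ i i).
- exact: eq_mxblock.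
- exact: eq_mxdiag.
Qed.

Definition state_cov m : 'M[R]_(\sum_(k < N.+1) d) :=
  invmx (Tmx N m) *m Pmx N m *m (invmx (Tmx N m))^T.

Lemma admissible_units m :
  admissible N m -> Tmx N m \in unitmx /\ Pmx N m \in unitmx.
Proof. by move=> [c [_ _ uP]]; split => //; exact: Tmx_unit. Qed.

Lemma Pmx_state_cov m :
  admissible N m -> Tmx N m *m state_cov m *m (Tmx N m)^T = Pmx N m.
Proof.
move=> /admissible_units[uT _].
by rewrite /state_cov -!mulmxA mulKVmx// -trmx_mul mulmxV// trmx1 mulmx1.
Qed.

Lemma precisionE m : admissible N m -> precision m = invmx (state_cov m).
Proof.
move=> /admissible_units[uT uP].
have PC : precision m *m state_cov m = 1%:M.
  rewrite /precision /state_cov -!mulmxA mulKVmx// mulKmx//.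
  by rewrite -trmx_mul mulVmx// trmx1.
have [_ uC] := mulmx1_unit PC.
by rewrite -[LHS]mulmx1 -(mulmxV uC) mulmxA PC mul1mx.
Qed.

Lemma precision_state_cov m m' : admissible N m -> admissible N m' ->
  precision m = precision m' <-> state_cov m = state_cov m'.
Proof.
move=> am am'; rewrite !precisionE//; split=> [|->//].
exact: (inv_inj (@invmxK _ _)).
Qed.

End model_matrices.

(** * Governed sequences *)

Section governed_sequences.
Context (R : realType) (d N : nat).
Hypothesis hN : (2 <= N)%N.
Implicit Types m : model R d.

Definition noise_map m m' : 'M[R]_(\sum_(k < N.+1) d) :=
  Tmx N m' *m invmx (Tmx N m).

Lemma governs_state m d1 (Omega : measurableType d1) (Pr : probability Omega R)
    (x e : Omega -> trajectory R d N) :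
  governs m Pr x e -> forall w, x w = invmx (Tmx N m) *m e w.
Proof.
move=> [am _ eqs] w; have [uT _] := admissible_units hN am.
by move/(equations_stack m (x w) (e w) hN): (eqs w) => <-; rewrite mulKmx.
Qed.

Lemma governs_gaussian m d1 (Omega : measurableType d1) (Pr : probability Omega R)
    (x e : Omega -> trajectory R d N) :
  governs m Pr x e -> centered_gaussian Pr x /\ has_covariance Pr x (state_cov N m).
Proof.
move=> g; have [am [ge ce] _] := g.
have -> : x = (fun w => invmx (Tmx N m) *m e w).
  by apply/funext => w; exact: governs_state g w.
split; first exact: centered_gaussian_linear.
by apply: has_covariance_linear => //; case: ge.
Qed.

Variables m m' : model R d.
Hypotheses (am : admissible N m) (am' : admissible N m').

(** With [T'] the matrix of [m'], the mapped noise has covariance [T' C T'^T], where [C] is the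
    state covariance of [m], while [m'] demands [T' C' T'^T]; as [T'] is invertible, these agree
    exactly when [C = C']. *)
Lemma is_noise_map d1 (Omega : measurableType d1) (Pr : probability Omega R)
    (e : Omega -> trajectory R d N) : is_noise m Pr e ->
  is_noise m' Pr (fun w => noise_map m m' *m e w) <->
  precision N m' = precision N m.
Proof.
move=> [ge ce]; rewrite precision_state_cov//.
have [uT' _] := admissible_units hN am'.
have AE : noise_map m m' *m Pmx N m *m (noise_map m m')^T =
    Tmx N m' *m state_cov N m *m (Tmx N m')^T.
  by rewrite /noise_map /state_cov trmx_mul !mulmxA.
have ce' := has_covariance_linear (noise_map m m') ge.1 ce.
rewrite AE in ce'; split=> [[_ /has_covariance_unique/(_ ce')]|CC].
  rewrite -(Pmx_state_cov hN am') => TCT.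
  apply: (can_inj (mulKmx uT')); move: TCT.
  by apply: (can_inj (mulmxK _)); rewrite unitmx_tr.
split; first exact: centered_gaussian_linear.
by rewrite -CC (Pmx_state_cov hN am') in ce'.
Qed.

Lemma whitening_unit : (Tmx N m')^T *m invmx (Pmx N m') \in unitmx.
Proof.
have [uT' uP'] := admissible_units hN am'.
by rewrite unitmx_mul unitmx_tr uT' unitmx_inv.
Qed.

(** Insert [e = T (T^-1 e)] on the right: step (1) replaces the precision of [m] by that of [m'],
    and the invertible factor [T'^T P'^-1] cancels. *)
Lemma step2_noise_map (z e : trajectory R d N) :
  precision N m' = precision N m ->
  (Tmx N m')^T *m invmx (Pmx N m') *m z =
    (Tmx N m)^T *m invmx (Pmx N m) *m e <->
  z = noise_map m m' *m e.
Proof.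
move=> step1; have [uT _] := admissible_units hN am.
have -> : (Tmx N m)^T *m invmx (Pmx N m) *m e =
    (Tmx N m')^T *m invmx (Pmx N m') *m (noise_map m m' *m e).
  rewrite /noise_map -[X in _ = _ *m X]mulmxA [RHS]mulmxA.
  rewrite -/(precision N m') step1 /precision.
  by rewrite -[RHS]mulmxA mulKVmx.
by split=> [|->//]; exact: (can_inj (mulKmx whitening_unit)).
Qed.

End governed_sequences.

Theorem proposition3p1 (R : realType) (d N : nat) (hN : (2 <= N)%N)
    (m1 : model R d)
    (dOmega : measure_display) (Omega : measurableType dOmega)
    (Pr : probability Omega R) (x xi : Omega -> trajectory R d N)
    (h1 : governs m1 Pr x xi)
    (m2 : model R d) (h2 : admissible N m2) :
  let step1 (m : model R d) : Prop :=
    (Tmx N m)^T *m invmx (Pmx N m) *m Tmx N m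
    = (Tmx N m1)^T *m invmx (Pmx N m1) *m Tmx N m1 in
  let step2 (z e : trajectory R d N) : Prop :=
    (Tmx N m2)^T *m invmx (Pmx N m2) *m z
    = (Tmx N m1)^T *m invmx (Pmx N m1) *m e in
  [/\ (* the models are equivalent exactly when step (1) holds *)
      forall (dOmega' : measure_display) (Omega' : measurableType dOmega')
        (Pr' : probability Omega' R) (y zeta : Omega' -> trajectory R d N),
        governs m2 Pr' y zeta ->
        (same_distribution Pr x Pr' y <-> step1 m2),
      (* step (1) determines the parameters, T_2 and P_2, given the type *)
      step1 m2 -> forall m2' : model R d,
        admissible N m2' -> same_type m2 m2' -> step1 m2' ->
        [/\ same_parameters N m2 m2', Tmx N m2 = Tmx N m2' &
            Pmx N m2 = Pmx N m2'],
      (* explicit sample-equivalence is exactly steps (1) and (2) *)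
      forall Phi : trajectory R d N -> trajectory R d N,
        explicitly_sample_equivalent m1 m2 Phi
        <-> step1 m2 /\ (forall e, step2 (Phi e) e),
      (* step (2) determines the noise and boundary values of model 2 *)
      forall e : trajectory R d N, exists! z : trajectory R d N, step2 z e &
      (* the two steps for the given sequence and noise *)
      forall zeta : Omega -> trajectory R d N,
        governs m2 Pr x zeta
        <-> step1 m2 /\ (forall w, step2 (zeta w) (xi w))].
Proof.
move=> step1 step2; have [am1 noise1 eqs1] := h1.
have [uT1 _] := admissible_units hN am1.
have uW := whitening_unit hN h2.
have step2P := step2_noise_map hN am1 h2.
have state_noise v : equations m2 v
    (noise_map N m1 m2 *m (Tmx N m1 *m v) : trajectory R d N).
  by apply/(equations_stack m2 _ _ hN); rewrite /noise_map mulmxA mulmxKV.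
split.
- move=> dOmega' Omega' Pr' y zeta h.
  have [gx cx] := governs_gaussian hN h1; have [gy cy] := governs_gaussian hN h.
  rewrite (gaussian_same_distribution gx cx gy cy).
  by rewrite /step1 -/(precision N m2) -/(precision N m1) precision_state_cov.
- move=> s1 m2' am2' ty s1'; apply: precision_parameters => //.
  by rewrite /precision -/(step1 _) s1 s1'.
- move=> Phi; split=> [[noiseP eqsP]|[s1 s2]].
    (* No linearity of [Phi] is assumed: every [e] is the noise of the path [T_1^-1 e], and the
       second model's equations on that path force the value [Phi e]. *)
    have PhiE e : Phi e = noise_map N m1 m2 *m e.
      have /eqsP/(equations_stack m2 _ _ hN) <- :
          equations m1 (invmx (Tmx N m1) *m e) e.
        by apply/(equations_stack m1 _ _ hN); rewrite mulKVmx.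
      by rewrite mulmxA.
    (* A condition on all noises of the first model yields step (1) only if such a noise exists; the
       given [xi] is one. *)
    have s1 : step1 m2.
      apply/(is_noise_map hN am1 h2 noise1).
      by have := noiseP _ _ _ _ noise1; congr is_noise; apply/funext => w /=.
    by split=> // e; apply/step2P.
  have PhiE e : Phi e = noise_map N m1 m2 *m e.
    by apply/step2P => //; exact: s2.
  split=> [d1 Om P e ne|v e].
    rewrite (_ : Phi \o e = fun w => noise_map N m1 m2 *m e w).
      exact/(is_noise_map hN am1 h2 ne).
    by apply/funext => w /=.
  by move/(equations_stack m1 _ _ hN) => <-; rewrite PhiE.
- move=> e; exists (invmx ((Tmx N m2)^T *m invmx (Pmx N m2)) *m
    ((Tmx N m1)^T *m invmx (Pmx N m1) *m e)).
  split=> [|z]; first by rewrite /step2 mulKVmx.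
  by rewrite /step2 => <-; rewrite mulKmx.
move=> zeta; split=> [h|[s1 s2]].
  have [_ noise2 eqs2] := h.
  (* The equations force [zeta = T_2 x] pathwise, so what remains is whether this vector has the
     prescribed covariance. *)
  have zetaE : zeta = (fun w => noise_map N m1 m2 *m xi w).
    apply/funext => w; move/(equations_stack m2 _ _ hN): (eqs2 w) => <-.
    by rewrite (governs_state hN h1) mulmxA.
  have s1 : step1 m2.
    by apply/(is_noise_map hN am1 h2 noise1); rewrite -zetaE.
  by split=> // w; apply/step2P; rewrite // zetaE.
have zetaE w : zeta w = noise_map N m1 m2 *m xi w.
  by apply/step2P => //; exact: s2.
split=> // [|w].
  rewrite (_ : zeta = fun w => noise_map N m1 m2 *m xi w); last exact/funext.
  exact/(is_noise_map hN am1 h2 noise1).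
rewrite zetaE; have /(equations_stack m1 _ _ hN) <- := eqs1 w.
exact: state_noise.
Qed.
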